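(* Let $\mathcal{C}$ be the set of functions $v:\mathbf{R}^+\to\mathbf{R}$, $v\in L_2(\mathbf{R}^+)$, for which there exist $\alpha>0$, $\beta>0$ and a rational number $q\in(\frac12,1)$ such that $\widehat V\in H^2$, where $\widehat V(p)=K_{\alpha,\beta,q}(p)^{-1}V(p)$ for $p\in\mathbf{C}^+$, $V=\mathcal{L}v$, and $K_{\alpha,\beta,q}(p)=e^{-\alpha(p+\beta)^q}$. Then $\mathcal{C}$ is everywhere dense in the space $L_2(\mathbf{R}^+)$ of real-valued square integrable functions.
   Context: Notation: $\mathbf{R}^+=[0,+\infty)$ and $\mathbf{C}^+=\{z\in\mathbf{C}:\operatorname{Re}z>0\}$. Laplace transform: $(\mathcal{L}v)(p)=\frac{1}{\sqrt{2\pi}}\int_0^\infty e^{-pt}v(t)\,dt$ for $p\in\mathbf{C}^+$. Hardy space: $H^2$ is the space of functions $h$ holomorphic on $\mathbf{C}^+$ with finite norm $\|h\|_{H^2}=\sup_{k>0}\|h(k+i\omega)\|_{L_2(\mathbf{R})}$, where the $L_2$ norm is taken in $\omega\in\mathbf{R}$. Kernel: in $K_{\alpha,\beta,q}(p)=e^{-\alpha(p+\beta)^q}$, $p\in\mathbf{C}^+$, the power $(p+\beta)^q$ is the branch whose argument is $q\operatorname{Arg}(p+\beta)$, with $\operatorname{Arg}z\in(-\pi,\pi]$ the principal value of the argument. *)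

(* Defs.v *)
From mathcomp Require Import all_boot all_order all_algebra.
From mathcomp Require Import complex.
From mathcomp Require Import all_classical all_reals all_analysis.

Set Implicit Arguments.
Unset Strict Implicit.
Unset Printing Implicit Defensive.
Import Order.TTheory GRing.Theory Num.Theory.
Import numFieldNormedType.Exports.

Local Open Scope classical_set_scope.
Local Open Scope ring_scope.
Local Open Scope complex_scope.

Local Notation Re := complex.Re.
Local Notation Im := complex.Im.
Local Notation mu := lebesgue_measure.

Section complex_functions.
Context {R : realType}.
Implicit Types (z p : R[i]) (q : R).

(* The norm `|z| of R[i] takes its values in R[i]; this is the same modulus
   as an element of R. *)
Definition cmod z : R := Normc.normc z.

Definition cexp z : R[i] :=
  (expR (Re z) * cos (Im z)) +i* (expR (Re z) * sin (Im z)).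

(* For z != 0 this is the argument of z that lies in ]-pi, pi] (see cargP);
   the value at 0 is irrelevant. *)
Definition carg z : R :=
  if 0 <= Im z then acos (Re z / cmod z) else - acos (Re z / cmod z).

(* The branch of z ^ q with modulus |z| ^ q and argument q Arg z. *)
Definition cpow z q : R[i] :=
  (cmod z `^ q * cos (q * carg z)) +i* (cmod z `^ q * sin (q * carg z)).

Definition Cplus : set R[i] := [set p | 0 < Re p].

(* The scalars are R[i], so this is complex differentiability. *)
Definition holomorphic_on (D : set R[i]) (h : R[i] -> R[i]) : Prop :=
  forall p, D p -> derivable (h : R[i]^o -> R[i]^o) p 1.

End complex_functions.

Section transforms.
Context {R : realType}.

Definition Rplus : set R := `[0, +oo[.

Definition Cintegral (D : set R) (f : R -> R[i]) : R[i] :=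
  (\int[mu]_(t in D) Re (f t)) +i* (\int[mu]_(t in D) Im (f t)).

Definition Laplace (v : R -> R) (p : R[i]) : R[i] :=
  ((Num.sqrt (2 * pi))^-1)%:C *
  Cintegral Rplus (fun t => cexp (- (p * t%:C)) * (v t)%:C).

(* The L2(R) norm of h on the vertical line of abscissa k, in [0, +oo]. *)
Definition line_norm (h : R[i] -> R[i]) (k : R) : \bar R :=
  'N[mu]_2%:E[(fun w : R => (cmod (h (k +i* w)))%:E)]%E.

Definition Hardy_norm (h : R[i] -> R[i]) : \bar R :=
  ereal_sup [set line_norm h k | k in [set k | 0 < k]].

Definition Hardy2 : set (R[i] -> R[i]) :=
  [set h | holomorphic_on Cplus h /\ (Hardy_norm h < +oo)%E].

Definition kernel_K (alpha beta q : R) (p : R[i]) : R[i] :=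
  cexp (- (alpha%:C * cpow (p + beta%:C) q)).

(* A function on [0, +oo[ is represented by a function on R of which only the
   values on [0, +oo[ matter: v \_ Rplus is v extended by 0. *)
Definition L2plus : set (R -> R) :=
  [set v | v \_ Rplus \in Lfun mu 2%:E].

Definition L2plus_dist (f g : R -> R) : \bar R :=
  'N[mu]_2%:E[EFin \o ((f \- g)%R \_ Rplus)]%E.

Definition dense_in_L2plus (A : set (R -> R)) : Prop :=
  A `<=` L2plus /\
  forall f, L2plus f -> forall e : R, 0 < e ->
    exists2 v, A v & (L2plus_dist f v < e%:E)%E.

Definition class_C : set (R -> R) :=
  [set v | L2plus v /\
    exists alpha beta : R, exists q : rat,
      [/\ 0 < alpha, 0 < beta, 2^-1 < q < 1 &
          Hardy2 (fun p => (kernel_K alpha beta (ratr q) p)^-1 *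
                           Laplace v p)]].

End transforms.

Arguments class_C : clear implicits.

(* carg z is the principal argument of z. *)
Lemma cargP (R : realType) (z : R[i]) : z != 0 ->
  - pi < carg z <= pi /\
  z = (cmod z * cos (carg z)) +i* (cmod z * sin (carg z)).
Proof.
case: z => a b; rewrite eq_complex /= negb_and => z0.
set r := cmod (a +i* b).
have r2 : r ^+ 2 = a ^+ 2 + b ^+ 2.
  by rewrite sqr_sqrtr// addr_ge0 ?sqr_ge0.
have r_gt0 : 0 < r.
  rewrite sqrtr_gt0 lt_neqAle addr_ge0 ?sqr_ge0// andbT eq_sym.
  by rewrite paddr_eq0 ?sqr_ge0// !sqrf_eq0 negb_and.
have rN0 : r != 0 by rewrite gt_eqF.
set c := a / r.
have c2 : 1 - c ^+ 2 = (b / r) ^+ 2.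
  rewrite !expr_div_n.
  have -> : b ^+ 2 = r ^+ 2 - a ^+ 2 by rewrite r2 [RHS]addrAC subrr add0r.
  by rewrite mulrBl divff ?expf_neq0.
have c1 : -1 <= c <= 1.
  by rewrite -ler_norml -(@expr_le1 _ 2)// real_normK ?num_real // -subr_ge0 c2 sqr_ge0.
have s : sin (acos c) = `|b| / r.
  by rewrite sin_acos// c2 sqrtr_sqr normrM normfV (gtr0_norm r_gt0).
have a_c : r * cos (acos c) = a.
  by rewrite acosK// /c mulrC divfK.
rewrite /carg /= -/r -/c; case: (lerP 0 b) => b0.
- split.
    by rewrite acos_lepi// andbT (lt_le_trans _ (acos_ge0 c1))// oppr_lt0 pi_gt0.
  by rewrite a_c s (ger0_norm b0) mulrC divfK.
have cN1 : -1 < c.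
  rewrite lt_neqAle (andP c1).1 andbT eq_sym; apply/eqP => cE.
  move: c2; rewrite cE sqrrN expr1n subrr => /esym/eqP.
  by rewrite sqrf_eq0 mulf_eq0 invr_eq0 (negPf rN0) orbF (lt_eqF b0).
split.
  rewrite ltrN2 acos_ltpi ?cN1 ?(andP c1).2//=.
  by rewrite (le_trans _ (pi_ge0 R))// oppr_le0 acos_ge0.
by rewrite cosN sinN a_c s (ltr0_norm b0) mulrN mulrC divfK// opprK.
Qed.

(* Main.v *)
Require Import Defs.
From mathcomp Require Import all_boot all_order all_algebra.
From mathcomp Require Import complex.
From mathcomp Require Import all_classical all_reals all_analysis.
From mathcomp Require Import measurable_realfun ring lra.

(** A function v supported in [0, T] whose k-th differences of step h are at most
    C (A (k+1)^(4/3) h)^k, a Gevrey condition of order 4/3, lies in the class with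
    q = 3/4 and beta = 1. Indeed (1 - e^(-hp))^k Lv is the transform of the k-th
    difference of v, and taking h of order 1/|p| and k of order |p|^(3/4) gives
    |Lv(p)| <= C' e^(-c |p|^(3/4)) for Re p >= 0, which beats |K(p)|^-1 when alpha is
    small against c. Differences, unlike derivatives, pass to pointwise limits, and
    only translations have to be integrated.

    Such functions are dense because there are Gevrey approximations of the Heaviside
    function: average a ramp successively over intervals of widths comparable to
    j^(-4/3). The widths are summable, so the limit still climbs from 0 to 1 on a
    short interval, while each average gains one factor 2h/a_j on the differences.
    A continuous function is then approximated by a step function with smoothed jumps. *)

Set Implicit Arguments.
Unset Strict Implicit.
Unset Printing Implicit Defensive.
Import Order.TTheory GRing.Theory Num.Theory.
Import numFieldNormedType.Exports.

Local Open Scope classical_set_scope.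
Local Open Scope ring_scope.
Local Open Scope complex_scope.

Local Notation Re := complex.Re.
Local Notation Im := complex.Im.
Local Notation mu := lebesgue_measure.

(** * The complex exponential and the power of exponent 3/4 *)

Section cmod_cexp.
Context {R : realType}.
Implicit Types (z w p : R[i]).

(** Decay of exponent 1 is out of reach: if $V(i\omega)=O(e^{-c|\omega|})$, then $v$ is analytic
    near the real line, and bounded support forces $v=0$. Every exponent below 1 leaves room, and
    Gevrey order $s$ yields the exponent $1/s$, hence the pair $4/3$, $3/4$. Inside $(\frac12,1)$
    the value $3/4$ makes the power algebraic, the cube of an iterated square root, so that
    holomorphy of the kernel rests on identities for square roots.

    The decay is spent in two halves: one pays for $|K|^{-1}$, the other makes the product square
    integrable with a bound common to all vertical lines.

    A function of the class built here is continuous on $\mathbf{R}$ and vanishes for $t\le 0$,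
    whereas the target may be anything near $0$. Pointwise convergence is therefore lost at $t=0$;
    this is a null set, and uniform bounds with dominated convergence give convergence in $L_2$. *)

Lemma cmodM z w : cmod (z * w) = cmod z * cmod w.
Proof. exact: Normc.normcM. Qed.

Lemma cmodX z n : cmod (z ^+ n) = cmod z ^+ n.
Proof.
elim: n => [|n IH]; first by rewrite !expr0 /cmod Normc.normc1.
by rewrite !exprS cmodM IH.
Qed.

Lemma cmodV z : cmod z^-1 = (cmod z)^-1.
Proof. exact: Normc.normcV. Qed.

Lemma cmodN z : cmod (- z) = cmod z.
Proof. exact: normcN. Qed.

Lemma ler_cmodD z w : cmod (z + w) <= cmod z + cmod w.
Proof. exact: le_normcD. Qed.

Lemma cmod_ge0 z : 0 <= cmod z.
Proof. by case: z => a b /=; exact: sqrtr_ge0. Qed.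

Lemma cmod_eq0 z : (cmod z == 0) = (z == 0).
Proof.
apply/eqP/eqP => [/Normc.eq0_normc//|->]; exact: Normc.normc0.
Qed.

Lemma sqr_cmod z : cmod z ^+ 2 = Re z ^+ 2 + Im z ^+ 2.
Proof. by case: z => a b; rewrite sqr_sqrtr// addr_ge0 ?sqr_ge0. Qed.

Lemma cmod_real (r : R) : cmod r%:C = `|r|.
Proof. by rewrite /cmod /= expr0n/= addr0 sqrtr_sqr. Qed.

Lemma ler_Re_cmod z : `|Re z| <= cmod z.
Proof.
by rewrite -(@ler_pXn2r _ 2)// ?nnegrE ?cmod_ge0// real_normK ?num_real// sqr_cmod lerDl sqr_ge0.
Qed.

Lemma ler_Im_cmod z : `|Im z| <= cmod z.
Proof.
by rewrite -(@ler_pXn2r _ 2)// ?nnegrE ?cmod_ge0// real_normK ?num_real// sqr_cmod lerDr sqr_ge0.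
Qed.

Lemma ler_cmod_ReIm z : cmod z <= `|Re z| + `|Im z|.
Proof.
rewrite -(@ler_pXn2r _ 2)// ?nnegrE ?cmod_ge0 ?addr_ge0// sqr_cmod sqrrD.
rewrite !real_normK ?num_real// [leRHS]addrAC lerDl mulrn_wge0// mulr_ge0//.
Qed.

Lemma cmodE z : `|z| = (cmod z)%:C.
Proof. by rewrite normc_def; case: z. Qed.

Lemma cmod_cexp z : cmod (cexp z) = expR (Re z).
Proof.
rewrite /cmod /cexp /= !exprMn -mulrDr cos2Dsin2 mulr1 sqrtr_sqr ger0_norm//.
Qed.

Lemma cexpD z w : cexp (z + w) = cexp z * cexp w.
Proof.
case: z w => [a b] [c d]; rewrite /cexp /= expRD cosD sinD.
by apply/eqP; rewrite eq_complex /=; apply/andP; split; apply/eqP; ring.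
Qed.

Lemma cexp0 : cexp (0 : R[i]) = 1.
Proof. by rewrite /cexp /= expR0 cos0 sin0 mulr1 mulr0. Qed.

Lemma cexpNK z : cexp z * cexp (- z) = 1.
Proof. by rewrite -cexpD subrr cexp0. Qed.

Lemma cexp_neq0 z : cexp z != 0.
Proof. by rewrite -cmod_eq0 cmod_cexp gt_eqF// expR_gt0. Qed.

Lemma cexpV z : (cexp z)^-1 = cexp (- z).
Proof. by apply: (mulfI (cexp_neq0 z)); rewrite mulfV ?cexp_neq0// cexpNK. Qed.

(** Only $1+y\le e^y$ is used: at $y=x$ for the lower bound, and at $y=-x/2$, squared, for
    $e^x\le(1-x/2)^{-2}$. What remains is a polynomial inequality on $[-1,1]$. *)
Lemma expR_remainder (x : R) : `|x| <= 1 -> `|expR x - 1 - x| <= 2 * x ^+ 2.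
Proof.
rewrite ler_norml => /andP[x1 x2].
have h1 := expR_ge1Dx x.
rewrite ger0_norm; last by lra.
have h3 := expR_ge1Dx (- (x / 2)).
have y0 := expR_gt0 (x / 2).
have ex2 : expR (x / 2) * expR (- (x / 2)) = 1 by rewrite -expRD subrr expR0.
have -> : expR x = expR (x / 2) ^+ 2.
  by rewrite -expRM_natl -mulr_natl mulrC divfK.
have e2 : expR (x / 2) * (1 - x / 2) <= 1.
  by rewrite -[leRHS]ex2 ler_pM2l.
have yx : expR (x / 2) ^+ 2 * (1 - x / 2) ^+ 2 <= 1.
  rewrite -exprMn; apply: exprn_ile1 => //; apply: mulr_ge0; lra.
have d0 : 0 < (1 - x / 2) ^+ 2 by apply: exprn_gt0; lra.
rewrite 2!lerBlDr -(ler_pM2r d0) (le_trans yx)// -subr_ge0.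
have -> : (2 * x ^+ 2 + x + 1) * (1 - x / 2) ^+ 2 - 1 =
  x ^+ 2 * ((1 - x) * (5 - 2 * x)) / 4 by field.
apply: divr_ge0 => //; apply: mulr_ge0; first exact: sqr_ge0.
apply: mulr_ge0; lra.
Qed.
End cmod_cexp.

(** * Complex differentiability of the exponential and of the power 3/4 *)

Section remainder.
Context {R : realType}.
Implicit Types (z w p : R[i]).

Lemma ler_abs_sin (y : R) : `|sin y| <= `|y|.
Proof.
wlog y0 : y / 0 <= y => [H|].
  have [/H//|y0] := leP 0 y.
  by rewrite -[y]opprK sinN !normrN -normrN; move: (H (- y)); rewrite !normrN; apply; lra.
have [|c _] := @MVT_segment R sin cos 0 y y0 (fun x _ => is_derive_sin x).
  by apply: continuous_subspaceT => x; exact: continuous_sin.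
rewrite sin0 !subr0 => ->; rewrite normrM ler_piMl//; exact: cos_max.
Qed.

Lemma ler_1Bcos (y : R) : 0 <= 1 - cos y <= y ^+ 2 / 2.
Proof.
have -> : 1 - cos y = 2 * sin (y / 2) ^+ 2.
  have {1}-> : y = (y / 2) *+ 2 by rewrite -mulr_natr divfK.
  by rewrite cos_mulr2n cos2sin2 -mulr_natr; ring.
have := ler_abs_sin (y / 2).
rewrite -(@ler_pXn2r _ 2)// ?nnegrE// !real_normK ?num_real// => h.
have := sqr_ge0 (sin (y/2)).
by rewrite expr_div_n in h *; lra.
Qed.

Lemma sin_remainder (y : R) : `|y| <= 1 -> `|sin y - y| <= y ^+ 2.
Proof.
wlog y0 : y / 0 <= y => [H|].
  have [/H//|y0] := leP 0 y => y1.
  by have := H (- y); rewrite normrN sqrrN sinN -opprD normrN; apply => //; lra.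
rewrite ger0_norm// => y1.
have d (x : R) : is_derive x 1 (fun t : R => sin t - t) (cos x - 1).
  exact: is_deriveB.
have [|c /[!in_itv]/= /andP[c0 c1]] := @MVT_segment R _ _ 0 y y0 (fun x _ => d x).
  apply: continuous_subspaceT => x; apply/differentiable_continuous.
  by apply/derivable1_diffP; have [] := d x.
rewrite sin0 !subr0 => ->; rewrite normrM (ger0_norm y0) ler_wpM2r//.
have /andP[h1 h2] := ler_1Bcos c; rewrite distrC ger0_norm//.
have : c ^+ 2 <= y by rewrite expr2 -[leRHS]mulr1 ler_pM//; lra.
lra.
Qed.

(** The real and imaginary parts are at most $2x^2+y^2$ and $2x^2+|x||y|+y^2$; with
    $|x||y|\le(x^2+y^2)/2$ the sum stays below $5(x^2+y^2)$. *)
Lemma cexp_remainder z : cmod z <= 1 -> cmod (cexp z - 1 - z) <= 5 * cmod z ^+ 2.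
Proof.
move=> z1; have zx := le_trans (ler_Re_cmod z) z1; have zy := le_trans (ler_Im_cmod z) z1.
rewrite sqr_cmod (le_trans (ler_cmod_ReIm _))//.
case: z z1 zx zy => x y /= _ x1 y1; rewrite subr0.
have ex := expR_remainder x1; have sy := sin_remainder y1.
have /andP[cy1 cy2] := ler_1Bcos y.
have -> : expR x * cos y - 1 - x = (expR x - 1 - x) * cos y - (1 + x) * (1 - cos y) by ring.
have -> : expR x * sin y - y = (expR x - 1 - x) * sin y + x * sin y + (sin y - y) by ring.
have x2 : `|x| ^+ 2 = x ^+ 2 by rewrite real_normK ?num_real.
have y2 : `|y| ^+ 2 = y ^+ 2 by rewrite real_normK ?num_real.
have e1 : `|(expR x - 1 - x) * cos y - (1 + x) * (1 - cos y)| <= 2 * x ^+ 2 + y ^+ 2.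
  apply: (le_trans (ler_normB _ _)); rewrite lerD//.
    by rewrite normrM -[leRHS]mulr1 ler_pM// cos_max.
  rewrite normrM (ger0_norm cy1).
  have u2 : `|1 + x| <= 2.
    by rewrite (le_trans (ler_normD _ _))// normr1; lra.
  have -> : y ^+ 2 = 2 * (y ^+ 2 / 2) by field.
  by rewrite ler_pM.
have e2 : `|(expR x - 1 - x) * sin y + x * sin y + (sin y - y)| <= 2 * x ^+ 2 + `|x| * `|y| + y ^+ 2.
  apply: (le_trans (ler_normD _ _)); rewrite lerD//.
  apply: (le_trans (ler_normD _ _)); rewrite !normrM lerD//.
    by rewrite -[leRHS]mulr1 ler_pM// sin_max.
  by rewrite ler_pM// ler_abs_sin.
have e3 : `|x| * `|y| <= (x ^+ 2 + y ^+ 2) / 2.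
  by rewrite -x2 -y2; have := sqr_ge0 (`|x| - `|y|); rewrite sqrrB; lra.
have := sqr_ge0 y; have := sqr_ge0 x; lra.
Qed.

(** The function $1-e^{-z}$ vanishes at all multiples of $2\pi i$, so a lower bound can only be
    local. This is what ties the step $h$ to $1/|p|$ later. The radius $1/10$ makes the remainder
    $5|z|^2$ at most $|z|/2$. *)
Lemma cmod_1Bcexp z : cmod z <= 10^-1 -> cmod z / 2 <= cmod (1 - cexp (- z)).
Proof.
move=> z6; have z0 := cmod_ge0 z.
have := @cexp_remainder (- z); rewrite cmodN => /(_ _)/wrap[|h]; first by lra.
have -> : 1 - cexp (- z) = z - (cexp (- z) - 1 - - z) by ring.
have := ler_cmodD (z - (cexp (- z) - 1 - - z)) (cexp (- z) - 1 - - z).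
rewrite subrK => h'.
have : cmod z ^+ 2 <= cmod z / 10 by rewrite expr2 ler_wpM2l.
lra.
Qed.

(** The exponential, the square root and the Laplace transform are all differentiated through an
    explicit quadratic remainder. *)
Lemma derivable_of_remainder (h : R[i] -> R[i]) p (W : R[i]) (C r : R) : 0 < r ->
  (forall z, cmod z <= r -> cmod (h (z + p) - h p - z * W) <= C * cmod z ^+ 2) ->
  derivable (h : R[i]^o -> R[i]^o) p 1.
Proof.
move=> r0 H; apply/cvg_ex; exists W.
apply/cvgrPdist_lt => e e0.
(* In the order of [R[i]] a positive number is real, so the tolerance is the image of a real one. *)
have [e' e'E] : exists e' : R, e = e'%:C.
  by move: e0; rewrite ltcE /= => /andP[/eqP ei _]; exists (Re e); case: e ei => a b /= ->.
move: e0; rewrite e'E ltcR => e'0.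
pose d := Num.min r (e' / (`|C| + 1)).
have C1 : 0 < `|C| + 1 by rewrite ltr_wpDl.
have d0 : 0 < d by rewrite lt_min r0 divr_gt0.
near=> z.
have z0 : z != 0 by near: z; exact: nbhs_dnbhs_neq.
have zd : cmod z < d.
  rewrite -ltcR -cmodE; near: z; apply: dnbhs0_lt; by rewrite ltcR.
move: zd; rewrite lt_min => /andP[zr ze].
rewrite cmodE ltcR.
have zp : 0 < cmod z by rewrite lt_def cmod_eq0 z0 cmod_ge0.
have -> : W - z^-1 *: ((h \o shift p) (z *: 1) - h p) = - (z^-1 * (h (z + p) - h p - z * W)).
  rewrite /shift /= /GRing.scale /= mulr1 [in RHS]mulrBr mulKf// opprB //.
rewrite cmodN cmodM cmodV mulrC ltr_pdivrMr//.
apply: (le_lt_trans (H _ (ltW zr))).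
rewrite expr2 mulrA ltr_pM2r//.
apply: (@le_lt_trans _ _ (`|C| * cmod z)); first by rewrite ler_wpM2r ?ler_norm// ltW.
move: ze; rewrite ltr_pdivlMr// mulrDr mulr1 mulrC => ze.
by apply: lt_trans ze; rewrite ltrDl.
Unshelve. all: by end_near.
Qed.

Lemma derivable_cexp p : derivable (cexp : R[i]^o -> R[i]^o) p 1.
Proof.
apply: (@derivable_of_remainder _ _ (cexp p) (5 * cmod (cexp p)) 1) => // z z1.
rewrite cexpD.
have -> : cexp z * cexp p - cexp p - z * cexp p = cexp p * (cexp z - 1 - z) by ring.
by rewrite cmodM mulrC mulrAC ler_wpM2r ?cmod_ge0// cexp_remainder.
Qed.

Lemma Re_sqrtc_ge0 z : 0 <= Re (sqrtc z).
Proof. by case: z => a b /=; exact: sqrtr_ge0. Qed.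

Lemma Re_sqrtc_gt0 z : 0 < Re z -> 0 < Re (sqrtc z).
Proof.
by case: z => a b /= a0; rewrite sqrtr_gt0 divr_gt0// ltr_wpDl ?sqrtr_ge0.
Qed.

(** With $u^2=z+p$ and $v^2=p$ one has $(u-v)(u+v)=z$, so the remainder is exactly $-(u-v)^2/(2v)$.
    Since $\operatorname{Re}u\ge0$, $|u+v|\ge\operatorname{Re}v$, which bounds $|u-v|$ by a multiple
    of $|z|$ without prior continuity of the root. *)
Lemma derivable_sqrtc p : 0 < Re p -> derivable (@sqrtc R : R[i]^o -> R[i]^o) p 1.
Proof.
move=> p0; have v0 := Re_sqrtc_gt0 p0.
set v := sqrtc p in v0; set d := Re v in v0.
have vn0 : v != 0 by apply: contraTN v0 => /eqP; rewrite /d => ->; rewrite ltxx.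
apply: (@derivable_of_remainder _ _ (2 * v)^-1 (d ^- 2 / cmod (2 * v)) 1) => // z _.
rewrite -/v; set u := sqrtc (z + p).
have uv : (u - v) * (u + v) = z.
  by rewrite -subr_sqr !sqr_sqrtc addrK.
have duv : d <= cmod (u + v).
  apply: (le_trans _ (ler_Re_cmod _)); apply: (le_trans _ (ler_norm _)).
  by rewrite raddfD /= lerDr Re_sqrtc_ge0.
have d0 : 0 < cmod (u + v) by exact: lt_le_trans duv.
have -> : u - v - z * (2 * v)^-1 = - ((u - v) ^+ 2 / (2 * v)).
  by rewrite -uv; field.
rewrite cmodN cmodM cmodV cmodX [leRHS]mulrAC ler_wpM2r ?invr_ge0 ?cmod_ge0//.
rewrite ler_pdivlMl ?exprn_gt0//.
rewrite -uv cmodM exprMn mulrC ler_wpM2l// ?ler_pXn2r// ?nnegrE ?cmod_ge0 ?exprn_ge0 ?cmod_ge0//; lra.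
Qed.

Lemma sqrtc_uniq z u : u ^+ 2 = z -> 0 < Re u -> sqrtc z = u.
Proof.
move=> uz u0; have /eqP := sqr_sqrtc z; rewrite -uz eqf_sqr => /orP[/eqP//|/eqP e].
have := Re_sqrtc_ge0 (u ^+ 2); by rewrite e raddfN /= oppr_ge0 leNgt u0.
Qed.

Lemma cmod_cpow z q : cmod (cpow z q) = cmod z `^ q.
Proof.
rewrite {1}/cmod /cpow /= !exprMn -mulrDr cos2Dsin2 mulr1 sqrtr_sqr ger0_norm//.
exact: powR_ge0.
Qed.

Definition cis (t : R) : R[i] := cexp (0 +i* t).
Lemma cisE t : cis t = cos t +i* sin t.
Proof. by rewrite /cis /cexp /= expR0 !mul1r. Qed.
Lemma cisD s t : cis (s + t) = cis s * cis t.
Proof. by rewrite /cis -cexpD; congr cexp; apply/eqP; rewrite eq_complex/= addr0 !eqxx. Qed.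

Lemma cpowE z q : cpow z q = (cmod z `^ q)%:C * cis (q * carg z).
Proof.
by rewrite cisE /cpow; apply/eqP; rewrite eq_complex/=; apply/andP; split; apply/eqP; ring.
Qed.

Lemma sqrtc_polar (r t : R) : 0 < r -> - pi < t < pi ->
  sqrtc (r%:C * cis t) = (r `^ (2^-1))%:C * cis (t / 2).
Proof.
move=> r0 /andP[t1 t2]; apply: sqrtc_uniq.
  rewrite exprMn [cis _ ^+ 2]expr2 -cisD -splitr -rmorphXn /=; congr (_%:C * _).
  by rewrite -powR_mulrn ?powR_ge0// -powRrM mulVf// powRr1// ltW.
rewrite cisE /= mul0r subr0 mulr_gt0 ?powR_gt0// cos_gt0_pihalf//.
by apply/andP; split; lra.
Qed.

Lemma carg_Re_gt0 z : 0 < Re z -> - pi < carg z < pi.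
Proof.
move=> z0; have zn0 : z != 0 by apply: contraTN z0 => /eqP ->; rewrite ltxx.
have [/andP[h1 h2] zE] := cargP zn0; rewrite h1 /= lt_def h2 andbT.
apply: contraTN z0 => /eqP e; rewrite zE /= -e cospi mulrN1 -leNgt.
by rewrite oppr_le0 cmod_ge0.
Qed.

(** Arguments in $(-\pi,\pi)$ are halved into $(-\pi/2,\pi/2)$, where the positive real part singles
    out the principal root. Two halvings and a cube multiply the argument by $3/4$. *)
Lemma cpow_sqrtc z : 0 < Re z -> cpow z (3 / 4) = sqrtc (sqrtc z) ^+ 3.
Proof.
move=> z0; have zn0 : z != 0 by apply: contraTN z0 => /eqP ->; rewrite ltxx.
have [_ zE] := cargP zn0.
have /andP[a1 a2] := carg_Re_gt0 z0.
have r0 : 0 < cmod z by rewrite lt_def cmod_eq0 zn0 cmod_ge0.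
have zE' : z = (cmod z)%:C * cis (carg z).
  by rewrite [LHS]zE cisE; apply/eqP; rewrite eq_complex/= !mul0r subr0 addr0 !eqxx.
rewrite cpowE [in RHS]zE' sqrtc_polar ?a1// sqrtc_polar ?powR_gt0//; last first.
  by have := pi_gt0 R => pi0; apply/andP; split; lra.
rewrite exprMn -rmorphXn /= -powR_mulrn ?powR_ge0// -!powRrM.
congr ((_ `^ _)%:C * _); first by field.
rewrite !exprS expr0 mulr1 -!cisD; congr cis; by field.
Qed.

Lemma derivable_ccomp (f g : R[i] -> R[i]) p :
  derivable (f : R[i]^o -> R[i]^o) p 1 -> derivable (g : R[i]^o -> R[i]^o) (f p) 1 ->
  derivable ((g \o f) : R[i]^o -> R[i]^o) p 1.
Proof.
move=> /derivable1_diffP df /derivable1_diffP dg; apply/derivable1_diffP.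
exact: (@differentiable_comp _ (R[i]^o) (R[i]^o) (R[i]^o) f g p df dg).
Qed.

Lemma derivable_cpow p : 0 < Re p -> derivable ((fun z => cpow z (3 / 4)) : R[i]^o -> R[i]^o) p 1.
Proof.
move=> p0.
have d : derivable ((fun z => sqrtc (sqrtc z) ^+ 3) : R[i]^o -> R[i]^o) p 1.
  apply: (@derivableX _ _ (@sqrtc R \o @sqrtc R : R[i]^o -> R[i]^o) 3).
  apply: derivable_ccomp; apply: derivable_sqrtc => //; exact: Re_sqrtc_gt0.
apply: near_eq_derivable d.
(* The ball of radius [Re p] around [p] stays in the right half-plane, where the power is the cube
   of the double square root. *)
have : \forall z \near (p : R[i]^o), ball (p : R[i]^o) (Re p)%:C z.
  by apply: nbhsx_ballx; rewrite ltcR.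
apply: filterS => z; rewrite /ball /= cmodE ltcR => pz; apply/esym; apply: cpow_sqrtc.
move: pz => /(le_lt_trans (ler_Re_cmod _)); rewrite raddfB /= ltr_norml => /andP[_]; lra.
Qed.

End remainder.

(** * Gevrey approximations of the Heaviside function *)

Section backward_difference.
Context {R : realType}.
Implicit Types (f F : R -> R) (h a t : R).

Definition bdiff h f t := f t - f (t - h).

Lemma is_derive_of_remainder f (p W C : R) :
  (forall z, `|f (z + p) - f p - z * W| <= C * z ^+ 2) ->
  is_derive p 1 f W.
Proof.
move=> H.
have cv : h^-1 *: ((f \o shift p) (h *: (1 : R)) - f p) @[h --> 0^'] --> W.
  apply/cvgrPdist_lt => e e0.
  have C1 : 0 < `|C| + 1 by rewrite ltr_wpDl.
  near=> z.
  have z0 : z != 0 by near: z; exact: nbhs_dnbhs_neq.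
  have ze : `|z| < e / (`|C| + 1).
    by near: z; apply: dnbhs0_lt; rewrite divr_gt0.
  have zp : 0 < `|z| by rewrite normr_gt0.
  have -> : W - z^-1 *: ((f \o shift p) (z *: 1) - f p) = - (z^-1 * (f (z + p) - f p - z * W)).
    by rewrite /shift /= /GRing.scale /= mulr1 [in RHS]mulrBr mulKf// opprB.
  rewrite normrN normrM normfV mulrC ltr_pdivrMr//.
  apply: (le_lt_trans (H _)).
  rewrite -(@real_normK _ z) ?num_real// expr2 mulrA ltr_pM2r//.
  apply: (@le_lt_trans _ _ (`|C| * `|z|)); first by rewrite ler_wpM2r// ler_norm.
  move: ze; rewrite ltr_pdivlMr// mulrDr mulr1 mulrC => ze.
  by apply: lt_trans ze; rewrite ltrDl.
split; first by apply/cvg_ex; exists W.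
by apply: cvg_lim => //.
Unshelve. all: by end_near.
Qed.

Lemma is_derive_bdiff F f h : (forall x : R, is_derive x 1 F (f x)) ->
  forall x : R, is_derive x 1 (bdiff h F) (bdiff h f x).
Proof.
move=> d x; apply: is_deriveB.
have := @is_derive1_comp R F (shift (- h)) x (f (x - h)) 1 (d _) _.
rewrite mulr1; apply.
have := is_derive_shift x (1 : R) (- h); by [].
Qed.

Lemma is_derive_iter_bdiff F f h k : (forall x : R, is_derive x 1 F (f x)) ->
  forall x : R, is_derive x 1 (iter k (bdiff h) F) (iter k (bdiff h) f x).
Proof. by move=> d; elim: k => [|k IH] x //=; apply: is_derive_bdiff. Qed.

(** The average of [f] over an interval of length [a] is written as a difference quotient of an
    antiderivative, so the mean value theorem does the work of integral estimates. *)
Lemma bdiff_MVT F f a t : 0 <= a -> (forall x : R, is_derive x 1 F (f x)) ->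
  exists2 x, 0 <= x <= a & bdiff a F t = a * f (t - x).
Proof.
move=> a0 d; have ta : t - a <= t by rewrite gerBl.
have [|c /[!in_itv]/= /andP[c1 c2] cE] := @MVT_segment R F f (t - a) t ta (fun x _ => d x).
  apply: continuous_subspaceT => x; apply/differentiable_continuous.
  by apply/derivable1_diffP; have [] := d x.
exists (t - c); first by apply/andP; split; lra.
by rewrite /bdiff cE mulrC !subKr; congr (_ * _).
Qed.

Lemma bdiff_mean F a h :
  bdiff h (fun t => bdiff a F t / a) = (fun t => bdiff a (bdiff h F) t / a).
Proof.
apply/funext => t; rewrite /bdiff [t - h - a]addrAC; ring.
Qed.

Lemma iter_bdiff_mean F a h k :
  iter k (bdiff h) (fun t => bdiff a F t / a) =
  (fun t => bdiff a (iter k (bdiff h) F) t / a).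
Proof. by elim: k => //= k ->; rewrite bdiff_mean. Qed.

(* [ramp_tower e 0] climbs linearly from 0 to 1 on [0, e]; each [ramp_tower e j.+1]
   is an antiderivative of [ramp_tower e j]. *)
Definition ramp_tower (e : R) (j : nat) t : R :=
  (Num.max t 0 ^+ j.+1 - Num.max (t - e) 0 ^+ j.+1) / ((j.+1)`!%:R * e).

(** The square is the first power of the positive part that is differentiable at 0. Higher powers
    are its products with powers of $t$. *)
Lemma is_derive_pospart_sqr (x : R) :
  is_derive x 1 (fun t : R => Num.max t 0 ^+ 2) (2 * Num.max x 0).
Proof.
apply: (@is_derive_of_remainder _ _ _ 1) => z; rewrite mul1r.
have [zx|zx] := ltP (z + x) 0; have [x0|x0] := ltP x 0.
- by rewrite !expr0n/= mulr0 mulr0 !subr0 normr0 sqr_ge0.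
- rewrite expr0n/= ler_norml; apply/andP; split; nra.
- rewrite expr0n/= ler_norml; apply/andP; split; nra.
- have -> : (z + x) ^+ 2 - x ^+ 2 - z * (2 * x) = z ^+ 2 by ring.
  by rewrite ger0_norm// sqr_ge0.
Qed.

Lemma pospart_exp (t : R) j : Num.max t 0 ^+ j.+2 = Num.max t 0 ^+ 2 * t ^+ j.
Proof.
have [t0|t0] := ltP t 0; last by rewrite -exprD.
by rewrite !expr0n mul0r.
Qed.

Lemma is_derive_pospart (x : R) j :
  is_derive x 1 (fun t : R => Num.max t 0 ^+ j.+2) (j.+2%:R * Num.max x 0 ^+ j.+1).
Proof.
rewrite (_ : (fun t : R => _) = (fun t : R => Num.max t 0 ^+ 2) * (fun t : R => t ^+ j)); last first.
  by apply/funext => t; rewrite pospart_exp.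
have d1 := is_derive_pospart_sqr x.
have d2 : is_derive x 1 (fun t : R => t ^+ j) (j%:R * x ^+ j.-1).
  have := @is_deriveX R R id j x 1 1 _.
  rewrite /= (_ : id ^+ j = fun t : R => t ^+ j); last first.
    apply/funext => t; elim: j => [|j IH]; first by rewrite !expr0.
    by rewrite !exprS -IH.
  by move=> [h1 h2]; split => //; rewrite h2 /GRing.scale /= mulr1 mulr_natl.
have := @is_deriveM R R _ _ x 1 _ _ d1 d2.
congr is_derive; rewrite /GRing.scale /=.
have [x0|x0] := ltP x 0; first by rewrite !expr0n/= !mulr0 mul0r addr0.
case: j {d2} => [|j]; first by rewrite mul0r mulr0 add0r expr0 expr1 mul1r.
rewrite /= !exprS -(addn2 j.+1) -(addn1 j) !natrD; ring.
Qed.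

Lemma is_derive_ramp_tower (e : R) j (x : R) : 0 < e ->
  is_derive x 1 (ramp_tower e j.+1) (ramp_tower e j x).
Proof.
move=> e0; pose c := ((j.+2)`!%:R * e)^-1.
have E i : ramp_tower e i = (fun t => ((i.+1)`!%:R * e)^-1 * bdiff e (fun s => Num.max s 0 ^+ i.+1) t).
  by apply/funext => t; rewrite /ramp_tower /bdiff mulrC.
have d1 := @is_derive_bdiff _ _ e (fun y => is_derive_pospart y j) x.
have := @is_deriveZ R R R _ c x 1 _ d1.
rewrite E => h; have -> : ramp_tower e j x = c *: bdiff e (fun y => j.+2%:R * Num.max y 0 ^+ j.+1) x; last exact: h.
rewrite /ramp_tower /bdiff /c /GRing.scale /= -mulrBr mulrA [RHS]mulrC; congr (_ * _).
rewrite [in RHS]factS natrM.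
have f0 : (j.+1)`!%:R != 0 :> R by rewrite pnatr_eq0 -lt0n fact_gt0.
field.
by rewrite f0 (gt_eqF e0) /= -(natrD _ 2 j) pnatr_eq0.
Qed.
End backward_difference.

(** * The limit of iterated averages of a ramp *)

Section smooth_step.
Context {R : realType}.
Variables (a : nat -> R) (e : R).
Hypotheses (a0 : forall n, 0 < a n) (e0 : 0 < e).
Implicit Types (h t : R).

(* [spline n 0] is the ramp averaged over intervals of lengths a_0, ..., a_(n-1), and
   [spline n j] is a j-fold antiderivative of it. *)
Fixpoint spline (n j : nat) : R -> R :=
  if n is m.+1 then fun t => bdiff (a m) (spline m j.+1) t / a m
  else ramp_tower e j.

Lemma is_derive_spline n j (x : R) :
  is_derive x 1 (spline n j.+1) (spline n j x).
Proof.
elim: n j x => [|n IH] j x /=; first exact: is_derive_ramp_tower.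
have := @is_deriveZ R R R _ (a n)^-1 x 1 _ (@is_derive_bdiff R _ _ (a n) (IH j.+1) x).
rewrite (_ : (a n)^-1 \*: bdiff (a n) (spline n j.+2) = (fun t : R => bdiff (a n) (spline n j.+2) t / a n)); last first.
  by apply/funext => t; rewrite -[LHS]/(_ * _) mulrC.
by rewrite /GRing.scale /= mulrC.
Qed.

(** Differences commute with averaging, and an average is a value at some point at distance at most
    $a_n$ to the left. Bounds uniform in $t$ thus pass from $n$ to $n+1$; the cases $k=0$ and $k=1$
    also give the range, the support and the monotonicity. *)
Lemma spline_step n k h t : exists2 x, 0 <= x <= a n &
  iter k (bdiff h) (spline n.+1 0) t = iter k (bdiff h) (spline n 0) (t - x).
Proof.
have [x xa xE] := @bdiff_MVT R _ _ (a n) t (ltW (a0 n))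
  (@is_derive_iter_bdiff R _ _ h k (@is_derive_spline n 0)).
exists x => //=; rewrite iter_bdiff_mean xE mulrC mulKf// gt_eqF//.
Qed.

Lemma spline0E t : spline 0 0 t = (Num.max t 0 - Num.max (t - e) 0) / e.
Proof. by rewrite /= /ramp_tower !expr1 mul1r. Qed.

Lemma spline01 n t : 0 <= spline n 0 t <= 1.
Proof.
have ee := e0.
elim: n t => [|n IH] t.
  have [h1 h2] : 0 <= Num.max t 0 - Num.max (t - e) 0 /\ Num.max t 0 - Num.max (t - e) 0 <= e.
    by split; have [?|?] := ltP t 0; have [?|?] := ltP (t - e) 0; lra.
  by rewrite spline0E ler_pdivrMr// mul1r h2 divr_ge0// ltW.
by have [x _ /= ->] := spline_step n 0 0 t; exact: IH.
Qed.

Lemma spline_le0 n t : t <= 0 -> spline n 0 t = 0.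
Proof.
have ee := e0.
elim: n t => [|n IH] t t0.
  rewrite spline0E (_ : _ - _ = 0) ?mul0r//.
  by have [?|?] := ltP t 0; have [?|?] := ltP (t - e) 0; lra.
by have [x /andP[x0 _] /= ->] := spline_step n 0 0 t; apply: IH; lra.
Qed.

Lemma spline_eq1 n t : e + \sum_(i < n) a i <= t -> spline n 0 t = 1.
Proof.
have ee := e0.
elim: n t => [|n IH] t.
  rewrite big_ord0 addr0 spline0E => et.
  rewrite (_ : _ - _ = e) ?divff ?gt_eqF//.
  by have [?|?] := ltP t 0; have [?|?] := ltP (t - e) 0; lra.
rewrite big_ord_recr /= => et.
by have [x /andP[x0 xa] /= ->] := spline_step n 0 0 t; apply: IH; lra.
Qed.

Lemma spline_nondecreasing n s t : s <= t -> spline n 0 s <= spline n 0 t.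
Proof.
have ee := e0.
elim: n s t => [|n IH] s t st.
  rewrite !spline0E ler_pM2r ?invr_gt0//.
  have [?|?] := ltP t 0; have [?|?] := ltP (t - e) 0;
  by have [?|?] := ltP s 0; have [?|?] := ltP (s - e) 0; lra.
(* With step $t-s$ the first difference at $t$ is the increment from $s$ to $t$. *)
have [x _] := spline_step n 1 (t - s) t.
rewrite [LHS]/(bdiff _ _ _) [RHS]/(bdiff _ _ _) subKr => E.
rewrite -subr_ge0 E subr_ge0; apply: IH; lra.
Qed.

Lemma spline_nonincreasing t : nonincreasing_seq (fun n => spline n 0 t).
Proof.
apply/nonincreasing_seqP => n.
by have [x /andP[x0 _] /= ->] := spline_step n 0 0 t; apply: spline_nondecreasing; lra.
Qed.

(** The new case is $k=n+1$. One of the differences falls on the antiderivative [spline n 1] and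
    yields a factor $h$ times the bound for $n$ differences of [spline n 0]. The average is a
    difference of two such terms divided by $a_n$, whence $2h/a_n$. *)
Lemma spline_bdiff k h n t : 0 < h -> (k <= n)%N ->
  `|iter k (bdiff h) (spline n 0) t| <= \prod_(i < k) (2 * h / a i).
Proof.
move=> h0; elim: n k t => [|n IH] k t.
  rewrite leqn0 => /eqP ->; rewrite big_ord0 /=.
  by have /andP[s0 s1] := spline01 0 t; rewrite ger0_norm.
rewrite leq_eqVlt ltnS => /predU1P[->|kn]; last first.
  by have [x _ ->] := spline_step n k h t; apply: IH.
rewrite big_ord_recr /= -iterS iter_bdiff_mean -/(spline).
set M := \prod_(i < n) _ in IH *.
have B s : `|iter n.+1 (bdiff h) (spline n 1) s| <= h * M.
  rewrite iterS.
  have [x _ ->] := @bdiff_MVT R _ _ h s (ltW h0)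
    (@is_derive_iter_bdiff R _ _ h n (@is_derive_spline n 0)).
  by rewrite normrM (gtr0_norm h0) ler_pM2l// /M IH.
rewrite normrM normfV (gtr0_norm (a0 n)) mulrA ler_pM2r ?invr_gt0//.
apply: (le_trans (ler_normB _ _)).
have -> : M * (2 * h) = h * M + h * M by ring.
by rewrite lerD// B.
Qed.

(** The pointwise limit exists by monotonicity, each average delaying the climb. A bound on the
    partial sums of the widths is what makes it reach 1. *)
Definition smooth_step t : R := limn (fun n => spline n 0 t).

Lemma cvg_spline t : spline n 0 t @[n --> \oo] --> smooth_step t.
Proof.
apply: (@nonincreasing_is_cvgn R (fun n => spline n 0 t)).
  exact: spline_nonincreasing.
by exists 0 => _ [n _ <-]; case/andP: (spline01 n t).
Qed.

Lemma cvg_iter_spline k h t :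
  iter k (bdiff h) (spline n 0) t @[n --> \oo] --> iter k (bdiff h) smooth_step t.
Proof.
elim: k t => [|k IH] t; first exact: cvg_spline.
by rewrite iterS; apply: cvgB; exact: IH.
Qed.

Let cvgn_le (u : nat -> R) (l M : R) :
  u n @[n --> \oo] --> l -> (\forall n \near \oo, u n <= M) -> l <= M.
Proof.
move=> ul uM; rewrite -(cvg_lim (@Rhausdorff R) ul).
by apply: limr_le => //; apply/cvg_ex; exists l.
Qed.

Let cvgn_ge (u : nat -> R) (l M : R) :
  u n @[n --> \oo] --> l -> (\forall n \near \oo, M <= u n) -> M <= l.
Proof.
move=> ul uM; rewrite -(cvg_lim (@Rhausdorff R) ul).
by apply: limr_ge => //; apply/cvg_ex; exists l.
Qed.

Lemma smooth_step_le0 t : t <= 0 -> smooth_step t = 0.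
Proof.
by move=> t0; apply: (cvg_lim (@Rhausdorff R)); under eq_fun do rewrite spline_le0//; exact: cvg_cst.
Qed.

Lemma smooth_step_nondecreasing s t : s <= t -> smooth_step s <= smooth_step t.
Proof.
move=> st; rewrite -subr_ge0.
apply: (cvgn_ge (cvgB (@cvg_spline t) (@cvg_spline s))).
by apply: nearW => n; rewrite subr_ge0 spline_nondecreasing.
Qed.

Lemma smooth_step_eq1 S t : (forall n, \sum_(i < n) a i <= S) -> e + S <= t ->
  smooth_step t = 1.
Proof.
move=> HS et; apply: (cvg_lim (@Rhausdorff R)); rewrite (_ : (fun n => _) = cst 1); last first.
  by apply/funext => n; rewrite spline_eq1// (le_trans _ et)// lerD2l HS.
exact: cvg_cst.
Qed.

Lemma smooth_step_bdiff k h t : 0 < h ->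
  `|iter k (bdiff h) smooth_step t| <= \prod_(i < k) (2 * h / a i).
Proof.
move=> h0; apply: (cvgn_le (cvg_norm (@cvg_iter_spline k h t))).
by exists k => // n /= kn; exact: spline_bdiff.
Qed.

End smooth_step.

(** * A smoothed Heaviside function of Gevrey order 4/3 *)

Section gevrey_step.
Context {R : realType}.

(* The widths 1/x_j - 1/x_(j+1) are summable by telescoping, and bounded below by
   (j+2)^(-4/3)/3 because x_(j+1)^3 - x_j^3 = 1. *)
Let x (j : nat) : R := j.+1%:R `^ (3^-1).

Let x3 j : x j ^+ 3 = j.+1%:R.
Proof. by rewrite /x -powR_mulrn ?powR_ge0// -powRrM mulVf// powRr1. Qed.

Let x_gt0 j : 0 < x j. Proof. by rewrite powR_gt0. Qed.

Let xS j : x j < x j.+1.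
Proof. by rewrite gt0_ltr_powR ?nnegrE// ltr_nat. Qed.

Let step_ge j : 3^-1 / x j.+1 ^+ 4 <= (x j)^-1 - (x j.+1)^-1.
Proof.
have := x3 j; have := x3 j.+1; have := xS j; have := x_gt0 j; have := x_gt0 j.+1.
set y := x j.+1; set z := x j => y0 z0 zy y3 z3.
have e1 : (y - z) * (y ^+ 2 + y * z + z ^+ 2) = 1.
  by rewrite [LHS](_ : _ = y ^+ 3 - z ^+ 3); [rewrite y3 z3 -natrB// subSnn | ring].
have -> : z^-1 - y^-1 = (y - z) / (z * y) by field; rewrite !gt_eqF.
have e2 : 3^-1 / y ^+ 2 <= y - z.
  rewrite ler_pdivrMr ?exprn_gt0//.
  have : (y - z) * (y ^+ 2 + y * z + z ^+ 2) <= (y - z) * (3 * y ^+ 2).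
    apply: ler_wpM2l; first lra.
    have h1 : y * z <= y ^+ 2 by rewrite expr2 ler_pM2l// ltW.
    have h2 : z ^+ 2 <= y ^+ 2 by rewrite ler_pXn2r ?nnegrE// ltW.
    lra.
  by rewrite e1; lra.
apply: (@le_trans _ _ ((y - z) / y ^+ 2)).
  have -> : y ^+ 4 = y ^+ 2 * y ^+ 2 by rewrite -exprD.
  rewrite invfM mulrA.
  by rewrite ler_pM2r// invr_gt0 exprn_gt0.
apply: ler_wpM2l; first lra.
by rewrite lef_pV2 ?posrE ?mulr_gt0 ?exprn_gt0// expr2 ler_pM2r// ltW.
Qed.

Lemma gevrey_step (e : R) : 0 < e -> exists (Phi : R -> R) (A : R),
  [/\ 0 < A, forall t, t <= 0 -> Phi t = 0, forall t, 2 * e <= t -> Phi t = 1,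
      {homo Phi : s t / s <= t} &
      forall k h t, 0 < h ->
        `|iter k (bdiff h) Phi t| <= (A * (k.+1%:R `^ (4 / 3)) * h) ^+ k].
Proof.
move=> e0; pose a j := e * ((x j)^-1 - (x j.+1)^-1).
have a0 j : 0 < a j.
  rewrite mulr_gt0// (lt_le_trans _ (step_ge j))// divr_gt0 ?exprn_gt0//.
have sa n : \sum_(i < n) a i = e * ((x 0)^-1 - (x n)^-1).
  elim: n => [|n IH]; first by rewrite big_ord0 subrr mulr0.
  by rewrite big_ord_recr /= IH /a; ring.
have x0 : x 0 = 1 by rewrite /x powR1.
(* From $a_i\ge e/(3x_{i+1}^4)$ follows $2h/a_i\le(6/e)\,x_{i+1}^4h$, and
   $x_{i+1}^4=(i+2)^{4/3}\le(k+1)^{4/3}$ for $i<k$. *)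
exists (smooth_step a e), (6 / e); split.
- by rewrite divr_gt0.
- by move=> t t0; exact: smooth_step_le0.
(* The ramp takes length $e$, and the widths add up to at most $e/x_0=e$. *)
- move=> t t2; apply: (@smooth_step_eq1 _ a e a0 e0 e) => [n|]; last lra.
  by rewrite sa x0 invr1 ger_pMr// gerBl invr_ge0 ltW.
- exact: smooth_step_nondecreasing.
move=> k h t h0; apply: (le_trans (smooth_step_bdiff a0 e0 k t h0)).
rewrite -[X in _ <= _ ^+ X](card_ord k) -prodr_const.
apply: ler_prod => i _; apply/andP; split.
  by apply: divr_ge0; [apply: mulr_ge0 => //; exact: ltW|exact: ltW].
rewrite ler_pdivrMr//.
have xk : x i.+1 ^+ 4 <= k.+1%:R `^ (4 / 3).
  rewrite /x -powR_mulrn ?powR_ge0// -powRrM [3^-1 * _]mulrC.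
  by rewrite ge0_ler_powR ?nnegrE// ler_nat ltnS.
have x4 : 0 < x i.+1 ^+ 4 by rewrite exprn_gt0.
have ai : e / 3 / x i.+1 ^+ 4 <= a i.
  by rewrite -!mulrA ler_pM2l//; exact: step_ge.
apply: (@le_trans _ _ (6 / e * x i.+1 ^+ 4 * h * (e / 3 / x i.+1 ^+ 4))).
  by rewrite le_eqVlt; apply/orP; left; apply/eqP; field; rewrite !gt_eqF.
apply: ler_pM => //.
- by apply/ltW/mulr_gt0 => //; apply/mulr_gt0 => //; exact: divr_gt0.
- by rewrite ltW// !divr_gt0.
by rewrite ler_pM2r// ler_pM2l// divr_gt0.
Qed.

End gevrey_step.

(** * Laplace transforms of functions with bounded support *)

Section integrals.
Context {R : realType}.
Implicit Types (v w f : R -> R) (F G : R -> R[i]) (p z : R[i]) (T M h t : R).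
Local Notation RplusR := (@Rplus R).

Lemma measurable_Rplus : measurable RplusR.
Proof. exact: measurable_itv. Qed.
Local Hint Resolve measurable_Rplus : core.

(** Vanishing is required to the left of 0 as well: integrals over the half-line and over
    $\mathbf{R}$ then agree, and translates to the right lose nothing. *)
Definition supp T f := forall t, ~~ (0 <= t <= T) -> f t = 0.

Lemma Rintegral_supp (D : set R) T f : measurable D -> `[0, T]%classic `<=` D ->
  supp T f -> \int[mu]_(t in D) f t = \int[mu]_(t in setT) f t.
Proof.
move=> mD TD sf; rewrite Rintegral_mkcond; congr Rintegral.
apply/funext => t; rewrite patchE; case: ifPn => // tD; apply/esym/sf.
apply: contra tD => t01; apply/mem_set/TD; by rewrite /= in_itv.
Qed.

Lemma sub_itv_Rplus T : `[0, T]%classic `<=` RplusR.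
Proof. by move=> t; rewrite /Rplus /= !in_itv/= andbT => /andP[]. Qed.

Lemma integrable_supp T M f : measurable_fun setT f -> (forall t, `|f t| <= M) ->
  supp T f -> mu.-integrable setT (EFin \o f).
Proof.
move=> mf fM sf.
have -> : EFin \o f = (EFin \o f) \_ `[0, T].
  apply/funext => t; rewrite patchE; case: ifPn => // tD /=; rewrite sf//.
  by apply: contra tD => t01; apply/mem_set; rewrite /= in_itv.
apply/(integrable_mkcond _ _).1 => //.
apply: measurable_bounded_integrable => //.
- by rewrite /= lebesgue_measure_itv/=; case: ifP => // _; rewrite -EFinD ltry.
- exact: measurable_funS mf.
- by exists M; split; rewrite ?num_real // => x Mx t _; exact: le_trans (ltW Mx).
Qed.

Lemma integrable_Rplus T M f : measurable_fun setT f -> (forall t, `|f t| <= M) ->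
  supp T f -> mu.-integrable RplusR (EFin \o f).
Proof. by move=> mf fM sf; apply: integrableS (integrable_supp mf fM sf). Qed.

Lemma Rintegral_Rplus_le T M f : 0 <= T -> measurable_fun setT f ->
  (forall t, `|f t| <= M) -> supp T f ->
  `|\int[mu]_(t in RplusR) f t| <= M * T.
Proof.
move=> T0 mf fM sf; rewrite (@Rintegral_supp _ T)//; last exact: sub_itv_Rplus.
rewrite -(@Rintegral_supp `[0, T] T)//.
have fi : mu.-integrable `[0, T] (EFin \o f).
  by apply: integrableS (integrable_supp mf fM sf).
apply: (le_trans (le_normr_Rintegral _ fi)) => //.
have mT : lebesgue_measure (`[0, T]%classic : set R) = T%:E.
  rewrite lebesgue_measure_itv/= lte_fin; case: ltP => [_|T0']; first by rewrite sube0.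
  by congr _%:E; apply/eqP; rewrite eq_le T0.
apply: (@le_trans _ _ (\int[mu]_(t in `[0, T]) M)).
  apply: le_Rintegral => //.
    by move: fi => /integrable_norm.
  apply: measurable_bounded_integrable => //; first by rewrite /= lebesgue_measure_itv/=; case: ifP => // _; rewrite -EFinD ltry.
  exists `|M|; split; rewrite ?num_real // => x Mx t _; exact: ltW.
rewrite Rintegral_cst// le_eqVlt; apply/orP; left; apply/eqP; congr (_ * _).
exact: (congr1 fine mT).
Qed.

Lemma Rintegral_shift T h f : 0 <= T -> 0 < h -> continuous f -> supp T f ->
  \int[mu]_(t in RplusR) f (t - h) = \int[mu]_(t in RplusR) f t.
Proof.
move=> T0 h0 cf sf.
have sfh : supp (T + h) (fun t => f (t - h)).
  move=> t th; apply: sf; apply: contra th; lra.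
rewrite (@Rintegral_supp _ T f)//; last exact: sub_itv_Rplus.
rewrite (@Rintegral_supp _ (T + h) (fun t => f (t - h)))//; last exact: sub_itv_Rplus.
(* Both integrals are brought to compact intervals that correspond under $t\mapsto t-h$. *)
rewrite -(@Rintegral_supp `[- h, T] T f)//; last first.
  by apply: subset_itvr => //; rewrite bnd_simp; lra.
rewrite -(@Rintegral_supp `[0, T + h] (T + h) (fun t => f (t - h)))//.
pose S := (fun t : R => t - h).
have dS t : is_derive t 1 S 1 by rewrite /S; exact: is_derive_shift.
have S1 : derive1 S = cst 1.
  by apply/funext => t; rewrite derive1E; have [] := dS t.
have cS : continuous S.
  move=> t; apply/differentiable_continuous/derivable1_diffP.
  by have [] := dS t.
have S0 : S 0 = - h by rewrite /S sub0r.
have ST : S (T + h) = T by rewrite /S addrK.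
rewrite /Rintegral; congr fine.
have := @integration_by_substitution_increasing R S f 0 (T + h).
rewrite S0 ST => ->.
- apply: eq_integral => t _; rewrite S1; congr EFin.
  by rewrite -[RHS]/(f (S t) * 1) mulr1.
- lra.
- by move=> x y _ _ xy; rewrite ltrD2r.
- by move=> x _; rewrite S1; exact: cvg_cst.
- by rewrite S1; exact: is_cvg_cst.
- by rewrite S1; exact: is_cvg_cst.
- split.
  + by move=> t _; have [] := dS t.
  + by apply: cvg_at_right_filter; exact: cS.
  + by apply: cvg_at_left_filter; exact: cS.
- by apply: continuous_subspaceT.
Qed.

Definition cintegrable F := mu.-integrable RplusR (EFin \o (fun t => Re (F t))) /\
  mu.-integrable RplusR (EFin \o (fun t => Im (F t))).

Lemma eq_cintegral F G : (forall t, 0 <= t -> F t = G t) -> Cintegral RplusR F = Cintegral RplusR G.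
Proof.
move=> FG; rewrite /Cintegral; congr (_ +i* _); apply: eq_Rintegral => t;
  by rewrite inE /Rplus /= in_itv/= andbT => t0; rewrite FG.
Qed.

Lemma cintegralB F G : cintegrable F -> cintegrable G ->
  Cintegral RplusR (fun t => F t - G t) = Cintegral RplusR F - Cintegral RplusR G.
Proof.
move=> [F1 F2] [G1 G2]; rewrite /Cintegral.
under eq_Rintegral do rewrite raddfB.
under [X in _ +i* X]eq_Rintegral do rewrite raddfB.
rewrite !RintegralB//.
Qed.

Lemma cintegralZ z F : cintegrable F ->
  Cintegral RplusR (fun t => z * F t) = z * Cintegral RplusR F.
Proof.
move=> [F1 F2]; case: z => x y; rewrite /Cintegral.
have Ei c f : mu.-integrable RplusR (EFin \o f) -> mu.-integrable RplusR (EFin \o (fun t => c * f t)).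
  by move=> fi; apply: eq_integrable (integrableZl _ c fi).
have -> : \int[mu]_(t in RplusR) Re ((x +i* y) * F t) = \int[mu]_(t in RplusR) (x * Re (F t) - y * Im (F t)).
  by apply: eq_Rintegral => t _; case: (F t).
have -> : \int[mu]_(t in RplusR) Im ((x +i* y) * F t) = \int[mu]_(t in RplusR) (x * Im (F t) + y * Re (F t)).
  by apply: eq_Rintegral => t _; case: (F t).
by rewrite RintegralB ?RintegralD ?RintegralZl//; exact: Ei.
Qed.

Definition csupp T M F :=
  [/\ measurable_fun setT (fun t => Re (F t)), measurable_fun setT (fun t => Im (F t)),
   (forall t, cmod (F t) <= M) & (forall t, ~~ (0 <= t <= T) -> F t = 0)].

Lemma csupp_integrable T M F : csupp T M F -> cintegrable F.
Proof.
move=> [m1 m2 b s]; split; apply: (@integrable_Rplus T M) => //.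
- by move=> t; exact: le_trans (ler_Re_cmod _) (b t).
- by move=> t /s ->.
- by move=> t; exact: le_trans (ler_Im_cmod _) (b t).
- by move=> t /s ->.
Qed.

(** The factor 2 comes from bounding the real and imaginary parts separately. *)
Lemma cmod_cintegral_le T M F : 0 <= T -> csupp T M F -> cmod (Cintegral RplusR F) <= 2 * M * T.
Proof.
move=> T0 [m1 m2 b s]; apply: (le_trans (ler_cmod_ReIm _)).
have -> : 2 * M * T = M * T + M * T by ring.
apply: lerD; apply: Rintegral_Rplus_le => //=.
- by move=> t; exact: le_trans (ler_Re_cmod _) (b t).
- by move=> t /s ->.
- by move=> t; exact: le_trans (ler_Im_cmod _) (b t).
- by move=> t /s ->.
Qed.

Lemma continuous_of_lipschitz (L : R) f :
  (forall s t, s <= t -> `|f t - f s| <= L * (t - s)) -> continuous f.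
Proof.
move=> fL x; apply/cvgrPdist_lt => e e0; near=> t.
have tx : `|x - t| < e / (`|L| + 1).
  near: t; apply: cvgr_dist_lt => //; by rewrite divr_gt0// ltr_wpDl.
have H : `|f x - f t| <= L * `|x - t|.
  have [xt|/ltW xt] := leP t x; first by rewrite (ger0_norm (x := x - t)) ?subr_ge0// fL.
  by rewrite distrC [`|x - t|]distrC (ger0_norm (x := t - x)) ?subr_ge0// fL.
move: tx; rewrite ltr_pdivlMr ?ltr_wpDl// => tx.
apply: (le_lt_trans H); apply: le_lt_trans tx.
rewrite mulrDr mulr1 (le_trans (y := `|x - t| * `|L|))// ?lerDl//.
by rewrite mulrC ler_wpM2l// ler_norm.
Unshelve. all: by end_near.
Qed.

End integrals.

(** * Laplace transforms of translates and differences *)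

Section laplace.
Context {R : realType}.
Implicit Types (v w : R -> R) (F G : R -> R[i]) (p z : R[i]) (T M N h t : R).
Local Notation RplusR := (@Rplus R).

Lemma csuppB T M N F G : csupp T M F -> csupp T N G ->
  csupp T (M + N) (fun t => F t - G t).
Proof.
move=> [f1 f2 f3 f4] [g1 g2 g3 g4]; split.
- by under eq_fun do rewrite raddfB; exact: measurable_funB.
- by under eq_fun do rewrite raddfB; exact: measurable_funB.
- by move=> t; rewrite (le_trans (ler_cmodD _ _))// cmodN lerD.
- by move=> t th; rewrite f4// g4// subrr.
Qed.

Lemma cReM z z' : Re (z * z') = Re z * Re z' - Im z * Im z'.
Proof. by case: z => a b; case: z' => c d. Qed.

Lemma cImM z z' : Im (z * z') = Re z * Im z' + Im z * Re z'.
Proof. by case: z => a b; case: z' => c d. Qed.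

Lemma csuppZ T M F z : csupp T M F -> csupp T (cmod z * M) (fun t => z * F t).
Proof.
move=> [f1 f2 f3 f4]; split.
- under eq_fun do rewrite cReM.
  by apply: measurable_funB; apply: measurable_funM.
- under eq_fun do rewrite cImM.
  by apply: measurable_funD; apply: measurable_funM.
- by move=> t; rewrite cmodM ler_wpM2l// cmod_ge0.
- by move=> t th; rewrite f4// mulr0.
Qed.

Definition cexpt p t : R[i] := cexp (- (p * t%:C)).

Lemma cexptE p t : cexpt p t =
  (expR (- (Re p * t)) * cos (Im p * t)) -i* (expR (- (Re p * t)) * sin (Im p * t)).
Proof.
case: p => x y; rewrite /cexpt /cexp /= !mulr0 subr0 add0r cosN sinN mulrN.
by [].
Qed.

Lemma cmod_cexpt p t : cmod (cexpt p t) = expR (- (Re p * t)).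
Proof. by rewrite cmod_cexp; congr expR; case: p => x y /=; rewrite mulr0 subr0. Qed.

Lemma cexptD p z t : cexpt (z + p) t = cexpt z t * cexpt p t.
Proof. by rewrite /cexpt mulrDl opprD cexpD. Qed.

Lemma cexpt_shift p h t : cexpt p t = cexpt p h * cexpt p (t - h).
Proof.
rewrite /cexpt -cexpD; congr cexp; rewrite -opprD -mulrDr -rmorphD /=; congr (- (_ * _%:C)).
by rewrite addrC subrK.
Qed.

Lemma Re_cexpt p t (r : R) : Re (cexpt p t * r%:C) = expR (- (Re p * t)) * cos (Im p * t) * r.
Proof. by rewrite cexptE /= mulr0 subr0. Qed.

Lemma Im_cexpt p t (r : R) : Im (cexpt p t * r%:C) = - (expR (- (Re p * t)) * sin (Im p * t)) * r.
Proof. by rewrite cexptE /= mulr0 add0r. Qed.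

Lemma continuous_expRN (a : R) : continuous (fun t : R => expR (- (a * t))).
Proof.
move=> t; apply: (@continuous_comp _ _ _ (fun t : R => - (a * t)) expR).
  by apply: cvgN; exact: mulrl_continuous.
exact: continuous_expR.
Qed.

Lemma continuous_Re_cexpt p : continuous (fun t : R => expR (- (Re p * t)) * cos (Im p * t)).
Proof.
move=> t; apply: cvgM; first exact: continuous_expRN.
apply: (@continuous_comp _ _ _ (fun t : R => Im p * t) cos); first exact: mulrl_continuous.
exact: continuous_cos.
Qed.

Lemma continuous_Im_cexpt p : continuous (fun t : R => - (expR (- (Re p * t)) * sin (Im p * t))).
Proof.
move=> t; apply: cvgN; apply: cvgM; first exact: continuous_expRN.
apply: (@continuous_comp _ _ _ (fun t : R => Im p * t) sin); first exact: mulrl_continuous.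
exact: continuous_sin.
Qed.

Lemma csupp_cexpt p T M N v : measurable_fun setT v -> (forall t, `|v t| <= M) -> supp T v ->
  (forall t, 0 <= t <= T -> expR (- (Re p * t)) <= N) -> 0 <= N ->
  csupp T (N * M) (fun t => cexpt p t * (v t)%:C).
Proof.
move=> mv vM sv eN N0; split.
- under eq_fun do rewrite Re_cexpt; apply: measurable_funM => //.
  apply: continuous_measurable_fun; exact: continuous_Re_cexpt.
- under eq_fun do rewrite Im_cexpt; apply: measurable_funM => //.
  apply: continuous_measurable_fun; exact: continuous_Im_cexpt.
- move=> t; rewrite cmodM cmod_cexpt cmod_real.
  have [tT|/negbTE tT] := boolP (0 <= t <= T); first by rewrite ler_pM// ?expR_ge0// eN.
  rewrite sv ?tT// normr0 mulr0 mulr_ge0//.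
  exact: le_trans (vM 0).
- by move=> t tT; rewrite sv// mulr0.
Qed.

Lemma expRN_le1 p t : 0 <= Re p -> 0 <= t -> expR (- (Re p * t)) <= 1.
Proof. by move=> p0 t0; rewrite -expR0 ler_expR oppr_le0 mulr_ge0. Qed.

Lemma csupp_cexpt_ge0 p T M v : 0 <= Re p -> measurable_fun setT v ->
  (forall t, `|v t| <= M) -> supp T v ->
  csupp T M (fun t => cexpt p t * (v t)%:C).
Proof.
move=> p0 mv vM sv; rewrite -[M]mul1r; apply: csupp_cexpt => //.
by move=> t /andP[t0 _]; exact: expRN_le1.
Qed.

Definition laplace_cst : R := (Num.sqrt (2 * pi))^-1.

Lemma laplace_cst_ge0 : 0 <= laplace_cst. Proof. by rewrite invr_ge0 sqrtr_ge0. Qed.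

Lemma laplace_cst_le1 : laplace_cst <= 1.
Proof.
rewrite /laplace_cst invf_le1; first by rewrite -[leLHS]sqrtr1 ler_sqrt; have := pi_ge2 R; lra.
by rewrite sqrtr_gt0 mulr_gt0// pi_gt0.
Qed.

Lemma LaplaceE v p : Laplace v p = laplace_cst%:C * Cintegral RplusR (fun t => cexpt p t * (v t)%:C).
Proof. by []. Qed.

Lemma cmod_Laplace_le p T M v : 0 <= T -> 0 <= Re p -> measurable_fun setT v ->
  (forall t, `|v t| <= M) -> supp T v -> cmod (Laplace v p) <= 2 * M * T.
Proof.
move=> T0 p0 mv vM sv; rewrite LaplaceE cmodM cmod_real ger0_norm ?laplace_cst_ge0//.
apply: (@le_trans _ _ (1 * (2 * M * T))); last by rewrite mul1r.
apply: ler_pM => //; rewrite ?laplace_cst_ge0 ?cmod_ge0 ?laplace_cst_le1//.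
by apply: cmod_cintegral_le => //; exact: csupp_cexpt_ge0.
Qed.

Lemma supp_shift T h v : 0 < h -> supp T v -> supp (T + h) (fun t => v (t - h)).
Proof. move=> h0 sv t th; apply: sv; apply: contra th; lra. Qed.

Lemma supp_bdiff T h v : 0 < h -> supp T v -> supp (T + h) (bdiff h v).
Proof.
move=> h0 sv t th; rewrite /bdiff (@supp_shift T h v)// sv ?subrr//.
by apply: contra th; lra.
Qed.

Lemma continuous_shift h v : continuous v -> continuous (fun t => v (t - h)).
Proof.
move=> cv t; apply: (@continuous_comp _ _ _ (fun t => t - h) v); last exact: cv.
by apply: cvgB; [exact: cvg_id|exact: cvg_cst].
Qed.

Lemma continuous_bdiff h v : continuous v -> continuous (bdiff h v).
Proof. by move=> cv t; apply: cvgB; [exact: cv|exact: continuous_shift]. Qed.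

(** Since $v$ vanishes to the left of 0, its translate is integrated over its whole support and no
    boundary term appears. *)
Lemma Laplace_shift p T M h v : 0 <= T -> 0 < h -> 0 <= Re p -> continuous v ->
  (forall t, `|v t| <= M) -> supp T v ->
  Laplace (fun t => v (t - h)) p = cexpt p h * Laplace v p.
Proof.
move=> T0 h0 p0 cv vM sv; rewrite !LaplaceE mulrCA; congr (_ * _).
have cs : csupp T M (fun t => cexpt p t * (v t)%:C).
  by apply: csupp_cexpt_ge0 => //; exact: continuous_measurable_fun.
rewrite -cintegralZ; last exact: csupp_integrable cs.
transitivity (Cintegral RplusR (fun t => cexpt p h * (cexpt p (t - h) * (v (t - h))%:C))).
  by apply: eq_cintegral => t _; rewrite mulrA -cexpt_shift.
have csh : csupp (T + h) M (fun t => cexpt p (t - h) * (v (t - h))%:C).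
  case: cs => m1 m2 b s; split.
  - apply: (measurableT_comp m1 (f := fun t => Re (cexpt p t * (v t)%:C)) (g := fun t => t - h)).
    by apply: measurable_funB => //; exact: measurable_cst.
  - apply: (measurableT_comp m2 (f := fun t => Im (cexpt p t * (v t)%:C)) (g := fun t => t - h)).
    by apply: measurable_funB => //; exact: measurable_cst.
  - by move=> t; exact: b.
  - by move=> t th; apply: s; apply: contra th; lra.
rewrite !cintegralZ; [|exact: csupp_integrable cs|exact: csupp_integrable csh].
congr (_ * _); rewrite /Cintegral; congr (_ +i* _).
  apply: (@Rintegral_shift _ T h (fun t => Re (cexpt p t * (v t)%:C))) => //.
    under [X in continuous X]eq_fun do rewrite Re_cexpt.
    by move=> t; apply: cvgM; [exact: continuous_Re_cexpt|exact: cv].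
  by move=> t tT; rewrite sv// mulr0.
apply: (@Rintegral_shift _ T h (fun t => Im (cexpt p t * (v t)%:C))) => //.
  under [X in continuous X]eq_fun do rewrite Im_cexpt.
  by move=> t; apply: cvgM; [exact: continuous_Im_cexpt|exact: cv].
by move=> t tT; rewrite sv// mulr0.
Qed.

Lemma Laplace_bdiff p T M h v : 0 <= T -> 0 < h -> 0 <= Re p -> continuous v ->
  (forall t, `|v t| <= M) -> supp T v ->
  Laplace (bdiff h v) p = (1 - cexpt p h) * Laplace v p.
Proof.
move=> T0 h0 p0 cv vM sv.
rewrite mulrBl mul1r -(@Laplace_shift p T M)// !LaplaceE -mulrBr; congr (_ * _).
rewrite -cintegralB.
- by apply: eq_cintegral => t _; rewrite -mulrBr -rmorphB.
- apply: (@csupp_integrable _ T M); apply: csupp_cexpt_ge0 => //.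
  exact: continuous_measurable_fun.
- apply: (@csupp_integrable _ (T + h) M); apply: csupp_cexpt_ge0 => //.
    apply: continuous_measurable_fun; exact: continuous_shift.
  exact: supp_shift.
Qed.

End laplace.

(** * Gevrey functions belong to the class *)

Section gevrey.
Context {R : realType}.
Implicit Types (v w : R -> R) (F G : R -> R[i]) (p z : R[i]) (T M N A C h t : R).
Local Notation RplusR := (@Rplus R).

(** Orders 0 and 1 already make [v] bounded by [C] and Lipschitz, which is the regularity that the
    integrals require. *)
Definition diff_bound C A v := forall k h t, 0 < h ->
  `|iter k (bdiff h) v t| <= C * (A * (k.+1%:R `^ (4 / 3)) * h) ^+ k.

Definition gevrey T C A v := supp T v /\ diff_bound C A v.

Lemma gevrey_bounded T C A v t : gevrey T C A v -> `|v t| <= C.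
Proof. by move=> [_ /(_ 0 1 t ltr01)] /=; rewrite expr0 mulr1. Qed.

Lemma gevrey_C_ge0 T C A v : gevrey T C A v -> 0 <= C.
Proof. by move=> g; exact: le_trans (gevrey_bounded 0 g). Qed.

Lemma gevrey_continuous T C A v : gevrey T C A v -> continuous v.
Proof.
move=> [_ g]; apply: (@continuous_of_lipschitz _ (C * (A * 2%:R `^ (4 / 3)))) => s t.
rewrite le_eqVlt => /predU1P[->|st]; first by rewrite !subrr normr0 mulr0.
have := g 1%N (t - s) t; rewrite subr_gt0 => /(_ st).
by rewrite /= /bdiff subKr expr1 !mulrA.
Qed.

Lemma continuous_iter_bdiff v h k : continuous v -> continuous (iter k (bdiff h) v).
Proof. by move=> cv; elim: k => [|k IH] //=; exact: continuous_bdiff. Qed.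

Lemma supp_iter_bdiff T v h k : 0 < h -> supp T v ->
  supp (T + k%:R * h) (iter k (bdiff h) v).
Proof.
move=> h0 sv; elim: k => [|k IH] /=; first by rewrite mul0r addr0.
by rewrite -natr1 mulrDl mul1r addrA; exact: supp_bdiff.
Qed.

Lemma Laplace_iter_bdiff T C A v p k h : 0 <= T -> gevrey T C A v -> 0 < h -> 0 <= Re p ->
  Laplace (iter k (bdiff h) v) p = (1 - cexpt p h) ^+ k * Laplace v p.
Proof.
move=> T0 g h0 p0; have cv := gevrey_continuous g.
have cvk j := @continuous_iter_bdiff v h j cv.
have svk j := @supp_iter_bdiff T v h j h0 g.1.
elim: k => [|k IH]; first by rewrite expr0 mul1r.
rewrite iterS (@Laplace_bdiff _ p (T + k%:R * h) (C * (A * (k.+1%:R `^ (4 / 3)) * h) ^+ k))//.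
- by rewrite IH mulrA exprS.
- by rewrite addr_ge0// mulr_ge0// ltW.
- by move=> t; exact: g.2.
Qed.

(** With $h=1/(10|p|)$ one has $|hp|=1/10$, hence $|1-e^{-hp}|\ge1/20$. Dividing the transform of
    the $k$-th difference by the $k$-th power of this factor costs $20^k$, and its support, of
    length $T+kh$, costs $2^k$. The constant is $4=20\cdot2/10$. *)
Lemma Laplace_decay_nat T C A v p k : 0 <= T -> 0 < A -> gevrey T C A v -> 0 <= Re p -> 1 <= cmod p ->
  cmod (Laplace v p) <= 2 * C * (T + 1) * (4 * A * (k.+1%:R `^ (4 / 3)) / cmod p) ^+ k.
Proof.
move=> T0 A0 g p0 p1; set r := cmod p in p1 *; have r0 : 0 < r by lra.
pose h := (10 * r)^-1; have h0 : 0 < h by rewrite invr_gt0 mulr_gt0.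
have h1 : h <= 1 by rewrite invf_le1 ?mulr_gt0//; lra.
have C0 := gevrey_C_ge0 g.
set K := k.+1%:R `^ (4 / 3); have K0 : 0 < K by rewrite powR_gt0.
have cv := gevrey_continuous g.
have L1 : 20^-1 <= cmod (1 - cexpt p h).
  have ph : cmod (p * h%:C) = 10^-1.
    by rewrite cmodM cmod_real (gtr0_norm h0) -/r /h; field; rewrite gt_eqF.
  have := @cmod_1Bcexp _ (p * h%:C); rewrite ph => /(_ (lexx _)).
  by rewrite (_ : 10^-1 / 2 = 20^-1)//; field.
have L2 : 20^-1 ^+ k * cmod (Laplace v p) <= cmod (Laplace (iter k (bdiff h) v) p).
  rewrite (Laplace_iter_bdiff k T0 g h0 p0) [leRHS]cmodM cmodX ler_wpM2r ?cmod_ge0//.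
  by apply: lerXn2r; rewrite ?nnegrE ?cmod_ge0.
have cvk j := @continuous_iter_bdiff v h j cv.
have svk j := @supp_iter_bdiff T v h j h0 g.1.
have L3 := @cmod_Laplace_le _ p (T + k%:R * h) (C * (A * K * h) ^+ k) (iter k (bdiff h) v).
have {}L3 : cmod (Laplace (iter k (bdiff h) v) p) <= 2 * (C * (A * K * h) ^+ k) * (T + k%:R * h).
  apply: L3 => //.
  - by rewrite addr_ge0// mulr_ge0// ltW.
  - exact: continuous_measurable_fun.
  - by move=> t; exact: g.2.
(* The growth of the support with $k$ is absorbed in the geometric factor; $|p|\ge1$ enters through
   $h\le1$. *)
have Tk : T + k%:R * h <= (T + 1) * 2 ^+ k.
  have k2 : k%:R <= 2 ^+ k :> R by rewrite -natrX ler_nat ltnW// ltn_expl.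
  have k1 : 1 <= 2 ^+ k :> R by rewrite exprn_ege1// ler1n.
  rewrite mulrDl mul1r; apply: lerD; first by rewrite ler_peMr.
  by apply: le_trans k2; rewrite ler_piMr.
have L4 : 20^-1 ^+ k * cmod (Laplace v p) <= 2 * (C * (A * K * h) ^+ k) * ((T + 1) * 2 ^+ k).
  apply: (le_trans L2); apply: (le_trans L3); apply: ler_wpM2l => //.
  by rewrite mulr_ge0// mulr_ge0// exprn_ge0// !mulr_ge0// ltW.
have d0 : (0 : R) < 20^-1 ^+ k by rewrite exprn_gt0.
rewrite -(ler_pM2l d0) (le_trans L4)// le_eqVlt; apply/orP; left; apply/eqP.
rewrite (_ : 4 * A * K / r = 20 * (2 * (A * K * h))); last by rewrite /h; field; rewrite gt_eqF.
rewrite !exprMn exprVn; field.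
by rewrite expf_neq0.
Qed.

(** For real $k=$ [rate A] $\cdot|p|^{3/4}$ the ratio $4Ak^{4/3}/|p|$ equals $1/e$. *)
Definition rate A : R := (4 * A * expR 1) `^ (- (3 / 4)).

Lemma rate_gt0 A : 0 < A -> 0 < rate A.
Proof. by move=> A0; rewrite powR_gt0// !mulr_gt0// expR_gt0. Qed.

(* The number k of differences is chosen so that (k+1)^(4/3) is about |p| / (4 A e). *)
Lemma Laplace_decay T C A v p : 0 <= T -> 1 <= A -> gevrey T C A v -> 0 <= Re p ->
  cmod (Laplace v p) <= 2 * C * (T + 1) * expR 2 * expR (- (rate A * cmod p `^ (3 / 4))).
Proof.
move=> T0 A1 g p0; have C0 := gevrey_C_ge0 g; have A0 : 0 < A by lra.
set r := rate A * cmod p `^ (3 / 4).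
have CT : 0 <= 2 * C * (T + 1) by rewrite !mulr_ge0// addr_ge0.
have e1 : 1 <= expR 1 :> R by rewrite -[leLHS]expR0 ler_expR.
have B0 : 0 < 4 * A * expR 1 by rewrite !mulr_gt0// expR_gt0.
have B1 : 1 <= 4 * A * expR 1.
  by rewrite -[leLHS]mulr1; apply: ler_pM => //; lra.
have rE : r = (cmod p / (4 * A * expR 1)) `^ (3 / 4).
  have Bi : (4 * A * expR 1)^-1 = (4 * A * expR 1) `^ (- 1) by rewrite powR_inv1// ltW.
  have Bi0 : 0 <= (4 * A * expR 1)^-1 by rewrite invr_ge0 ltW.
  rewrite (powRM (3 / 4) (cmod_ge0 p) Bi0) /r /rate mulrC Bi.
  by rewrite -powRrM mulN1r.
have r0 : 0 <= r by rewrite mulr_ge0 ?powR_ge0.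
rewrite -mulrA -expRD.
(* For $r<1$ the trivial bound is enough, as $e^{2-r}\ge1$. *)
have [r1|r1] := ltP r 1.
  apply: (@le_trans _ _ (2 * C * T)).
    apply: cmod_Laplace_le => //.
      by apply: continuous_measurable_fun; exact: gevrey_continuous g.
      by move=> t; exact: gevrey_bounded g.
    exact: g.1.
  apply: (@le_trans _ _ (2 * C * (T + 1) * 1)).
    by rewrite mulr1 ler_wpM2l ?mulr_ge0// lerDl.
  by rewrite ler_wpM2l// -[leLHS]expR0 ler_expR; lra.
have p1 : 4 * A * expR 1 <= cmod p.
  rewrite leNgt; apply/negP => pB.
  have : r < 1; last by lra.
  rewrite rE; apply: (@lt_le_trans _ _ (1 `^ (3 / 4))); last by rewrite powR1.
  apply: gt0_ltr_powR; rewrite ?nnegrE//; first by apply: divr_ge0; [exact: cmod_ge0|exact: ltW].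
  by rewrite ltr_pdivrMr// mul1r.
(* With $n=\lfloor r\rfloor$ and $n-1$ differences, $n^{4/3}\le r^{4/3}=|p|/(4Ae)$ makes each factor
   at most $1/e$. Since $n>r-1$, the product is at most $e^{-(n-1)}\le e^{2-r}$, which is the origin
   of $e^2$. *)
have := truncn_itv r0; set n := Num.truncn r => /andP[n1 n2].
have n0 : (0 < n)%N by rewrite truncn_gt0.
have := @Laplace_decay_nat T C A v p n.-1 T0 A0 g p0.
move=> /(_ _)/wrap[|H]; first by lra.
apply: (le_trans H) => {H}; apply: ler_wpM2l => //.
have cp : 0 < cmod p by exact: lt_le_trans p1.
rewrite prednK//.
apply: (@le_trans _ _ (expR (- 1) ^+ n.-1)).
  apply: lerXn2r; rewrite ?nnegrE ?expR_ge0//.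
    by rewrite divr_ge0 ?cmod_ge0// mulr_ge0 ?powR_ge0// mulr_ge0// ltW.
  rewrite ler_pdivrMr//.
  have : n%:R `^ (4 / 3) <= r `^ (4 / 3) by apply: ge0_ler_powR => //; rewrite nnegrE.
  rewrite [in leRHS]rE -powRrM (_ : 3 / 4 * (4 / 3) = 1); last by field.
  have q0 : 0 <= cmod p / (4 * A * expR 1) by apply: divr_ge0; exact: ltW.
  rewrite (powRr1 q0) ler_pdivlMr// => H'.
  rewrite expRN ler_pdivlMl ?expR_gt0// (le_trans _ H')// le_eqVlt; apply/orP; left; apply/eqP; ring.
rewrite -expRM_natl ler_expR -subn1 natrB//; move: n2; rewrite -natr1; lra.
Qed.

(** The derivative is the transform of $-tv(t)$. For $|z|\le1/(T+1)$ and $t\in[0,T]$ one has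
    $|zt|\le1$, so the quadratic remainder of the exponential is uniform in $t$ and can be
    integrated. *)
Lemma holomorphic_Laplace T C A v : 0 <= T -> gevrey T C A v ->
  holomorphic_on (@Cplus R) (Laplace v).
Proof.
move=> T0 g p p0; have cv := gevrey_continuous g.
have mv : measurable_fun setT v by exact: continuous_measurable_fun.
have vC t : `|v t| <= C by exact: gevrey_bounded g.
have C0 := gevrey_C_ge0 g.
pose w t := - (t * v t).
have mw : measurable_fun setT w.
  apply: continuous_measurable_fun => t; apply: cvgN; apply: cvgM; [exact: cvg_id|exact: cv].
have sw : supp T w by move=> t tT; rewrite /w g.1// mulr0 oppr0.
have wC t : `|w t| <= T * C.
  rewrite /w normrN normrM.
  have [/andP[t0 tT]|/negbTE tT] := boolP (0 <= t <= T).
    by rewrite ler_pM// ger0_norm.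
  by rewrite g.1 ?tT// normr0 mulr0 mulr_ge0.
pose W := Laplace w p.
apply: (@derivable_of_remainder _ _ _ W (2 * (5 * T ^+ 2 * C) * T) (T + 1)^-1).
  by rewrite invr_gt0 ltr_wpDl.
move=> z zT.
have zt t : 0 <= t <= T -> cmod (- (z * t%:C)) <= 1.
  move=> /andP[t0 tT]; rewrite cmodN cmodM cmod_real ger0_norm//.
  apply: (@le_trans _ _ ((T + 1)^-1 * (T + 1))); last by rewrite mulVf// gt_eqF// ltr_wpDl.
  by rewrite ler_pM ?cmod_ge0//; lra.
have c1 : csupp T C (fun t => cexpt p t * (v t)%:C).
  by apply: csupp_cexpt_ge0 => //; [exact: ltW|exact: g.1].
have c3 : csupp T (T * C) (fun t => cexpt p t * (w t)%:C).
  by apply: csupp_cexpt_ge0 => //; exact: ltW.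
(* Here $\operatorname{Re}(z+p)$ may be negative, but $|z|\le1$ keeps the exponential below $e^T$ on
   $[0,T]$. *)
have c2 : csupp T (expR T * C) (fun t => cexpt (z + p) t * (v t)%:C).
  apply: csupp_cexpt => //; [exact: g.1|].
  move=> t /andP[t0 tT]; rewrite ler_expR raddfD /= mulrDl opprD.
  have h1 : - (Re p * t) <= 0 by rewrite oppr_le0 mulr_ge0// ltW.
  have h2 : - (Re z * t) <= T.
    have := ler_Re_cmod z; rewrite ler_norml => /andP[h2 _].
    have : - Re z * t <= 1 * T; last by rewrite mul1r mulNr.
    apply: (@le_trans _ _ (cmod z * t)); first by rewrite ler_wpM2r//; lra.
    apply: ler_pM => //; first exact: cmod_ge0.
    by apply: (le_trans zT); rewrite invf_le1 ?ltr_wpDl//; lra.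
  lra.
rewrite /W !LaplaceE -mulrBr mulrCA -mulrBr cmodM cmod_real ger0_norm ?laplace_cst_ge0//.
rewrite -cintegralB; [|exact: csupp_integrable c2|exact: csupp_integrable c1].
rewrite -cintegralZ; last exact: csupp_integrable c3.
have c4 := csuppB (csuppB c2 c1) (csuppZ z c3).
rewrite -cintegralB; [|exact: csupp_integrable (csuppB c2 c1)|exact: csupp_integrable (csuppZ z c3)].
apply: (@le_trans _ _ (1 * (2 * (5 * T ^+ 2 * C * cmod z ^+ 2) * T))); last first.
  by rewrite mul1r le_eqVlt; apply/orP; left; apply/eqP; ring.
apply: ler_pM; rewrite ?laplace_cst_ge0 ?cmod_ge0 ?laplace_cst_le1//.
apply: cmod_cintegral_le => //.
case: c4 => m1 m2 _ s; split => // t.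
have [tT|/s ->] := boolP (0 <= t <= T); last first.
  by rewrite {1}/cmod Normc.normc0 !mulr_ge0 ?exprn_ge0 ?cmod_ge0.
rewrite cexptD (_ : _ - _ - _ = (cexp (- (z * t%:C)) - 1 - - (z * t%:C)) * (cexpt p t * (v t)%:C)); last first.
  by rewrite /w rmorphN rmorphM /= /cexpt; ring.
rewrite cmodM.
have h1 := cexp_remainder (zt t tT).
have h2 : cmod (cexpt p t * (v t)%:C) <= C by case: c1.
apply: (le_trans (ler_pM (cmod_ge0 _) (cmod_ge0 _) h1 h2)).
rewrite cmodN cmodM cmod_real.
have /andP[t0 tT'] := tT; rewrite (ger0_norm t0) exprMn.
have tT2 : t ^+ 2 <= T ^+ 2 by rewrite ler_pXn2r ?nnegrE.
rewrite [leRHS](_ : _ = 5 * (cmod z ^+ 2 * T ^+ 2) * C); last by ring.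
by rewrite ler_wpM2r// ler_wpM2l// ler_wpM2l// exprn_ge0// cmod_ge0.
Qed.

End gevrey.

(** * From decay to the Hardy space *)

Section class_C_gevrey.
Context {R : realType}.
Implicit Types (v w f : R -> R) (h : R[i] -> R[i]) (p z : R[i]) (T M N A C t k : R).

Lemma Lnorm2E f : ('N[mu]_2%:E[EFin \o f] = (\int[mu]_t ((f t) ^+ 2)%:E) `^ 2^-1)%E.
Proof.
rewrite unlock; congr (_ `^ _)%E; apply: eq_integral => t _ /=.
by rewrite (powR_mulrn 2 (normr_ge0 _)) real_normK// num_real.
Qed.

Lemma Lnorm2_le f M : 0 <= M -> (\int[mu]_t ((f t) ^+ 2)%:E <= (M ^+ 2)%:E)%E ->
  ('N[mu]_2%:E[EFin \o f] <= M%:E)%E.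
Proof.
move=> M0 fM; rewrite Lnorm2E.
have i0 : (0 <= \int[mu]_t ((f t) ^+ 2)%:E)%E by apply: integral_ge0 => t _; rewrite lee_fin sqr_ge0.
have M2 : (0 <= (M ^+ 2)%:E)%E by rewrite lee_fin sqr_ge0.
apply: (@le_trans _ _ ((M ^+ 2)%:E `^ 2^-1)%E).
  by apply: gt0_ler_poweR => //; rewrite in_itv/= ?leey ?andbT.
by rewrite poweR_EFin powR12_sqrt ?sqr_ge0// sqrtr_sqr ger0_norm.
Qed.

Lemma integral_oneDsqrV : exists2 S : R, 0 <= S & (\int[mu]_t ((1 + t ^+ 2)^-1)%:E <= S%:E)%E.
Proof.
exists (2 * (pi / 2)); first by rewrite !mulr_ge0// pi_ge0.
rewrite (@ge0_symfun_integralT R (fun t => (1 + t ^+ 2)^-1)).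
- by rewrite EFinM -(integral0y_oneDsqr R) set_itvcy.
- by move=> t; rewrite invr_ge0 addr_ge0// sqr_ge0.
- exact: continuous_oneDsqrV.
- by move=> t /=; rewrite sqrrN.
Qed.

Lemma continuous_cmod_line h k : holomorphic_on (@Cplus R) h -> 0 < k ->
  continuous (fun w : R => cmod (h (k +i* w))).
Proof.
move=> hh k0 w; apply/cvgrPdist_lt => e e0.
have hc : {for (k +i* w : R[i]^o), continuous (h : R[i]^o -> R[i]^o)}.
  by apply/differentiable_continuous/derivable1_diffP; exact: hh.
have e0c : 0 < e%:C :> R[i] by rewrite ltcR.
move/cvgrPdist_lt : hc => /(_ e%:C e0c) /nbhs_ballP[d /= d0 dh].
have [d' d'E] : exists d' : R, d = d'%:C.
  by move: d0; rewrite ltcE /= => /andP[/eqP di _]; exists (Re d); case: d di {dh} => a b /= ->.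
move: d0; rewrite d'E ltcR => d'0.
near=> t.
have wt : `|w - t| < d' by near: t; exact: cvgr_dist_lt.
have : `|h (k +i* w) - h (k +i* t)| < e%:C.
  apply: dh; rewrite /ball /= d'E cmodE ltcR.
  by rewrite /= subrr expr0n/= add0r sqrtr_sqr.
rewrite cmodE ltcR; apply: le_lt_trans.
have := ler_cmodD (h (k +i* w) - h (k +i* t)) (h (k +i* t)); rewrite subrK.
have := ler_cmodD (h (k +i* t) - h (k +i* w)) (h (k +i* w)); rewrite subrK.
rewrite -[cmod (h (k +i* t) - _)]cmodN opprB => h1 h2.
by rewrite ler_norml; apply/andP; split; [rewrite lerNl opprB|]; rewrite lerBlDr.
Unshelve. all: by end_near.
Qed.

(** The majorant depends on the ordinate only, so a single integral of $1/(1+\omega^2)$ bounds the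
    norms on all vertical lines at once. *)
Lemma Hardy2_of_bound h M : 0 <= M -> holomorphic_on (@Cplus R) h ->
  (forall p, Cplus p -> cmod (h p) ^+ 2 <= M / (1 + (Im p) ^+ 2)) -> Hardy2 h.
Proof.
move=> M0 hh hM; split => //.
have [S S0 SE] := integral_oneDsqrV.
apply: (@le_lt_trans _ _ (Num.sqrt (M * S))%:E); last by rewrite ltry.
apply: ge_ereal_sup => _ [k /= k0 <-].
have -> : line_norm h k = 'N[mu]_2%:E[EFin \o (fun t : R => cmod (h (k +i* t)))]%E by [].
apply: Lnorm2_le; first exact: sqrtr_ge0.
rewrite sqr_sqrtr ?mulr_ge0//.
apply: (@le_trans _ _ (\int[mu]_t (M%:E * ((1 + t ^+ 2)^-1)%:E))%E).
  apply: ge0_le_integral => //.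
  - by move=> t _; rewrite lee_fin sqr_ge0.
  - apply/measurable_EFinP; apply: measurable_funX.
    apply: continuous_measurable_fun; exact: continuous_cmod_line.
  - apply/measurable_EFinP; apply: measurable_funM => //.
    apply: continuous_measurable_fun; exact: continuous_oneDsqrV.
  - by move=> t _; rewrite lee_fin; exact: (hM (k +i* t)).
rewrite ge0_integralZl//.
- by rewrite EFinM lee_wpmul2l.
- apply/measurable_EFinP; apply: continuous_measurable_fun; exact: continuous_oneDsqrV.
- by move=> t _; rewrite lee_fin invr_ge0 addr_ge0// sqr_ge0.
Qed.

(** This is the price of the shift by $\beta=1$; the additive 2 turns into a constant factor of
    $|K|^{-1}$. *)
Lemma powRD1_le (x : R) : 0 <= x -> (x + 1) `^ (3 / 4) <= 2 * x `^ (3 / 4) + 2.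
Proof.
move=> x0.
have [x1|x1] := leP x 1.
  have := powR_ge0 x (3 / 4).
  have : (x + 1) `^ (3 / 4) <= 2 `^ (3 / 4) by rewrite ge0_ler_powR ?nnegrE//; lra.
  have : 2 `^ (3 / 4) <= (2 : R); last by lra.
  by rewrite -[leRHS]powRr1// ler_powR//; lra.
have := powR_ge0 x (3 / 4).
have : (x + 1) `^ (3 / 4) <= (2 * x) `^ (3 / 4) by rewrite ge0_ler_powR ?nnegrE//; lra.
rewrite powRM//.
have : 2 `^ (3 / 4) * x `^ (3 / 4) <= 2 * x `^ (3 / 4); last by lra.
rewrite ler_wpM2r ?powR_ge0//.
by rewrite -[leRHS]powRr1// ler_powR//; lra.
Qed.

Lemma oneDsqr_le_pow (x : R) : 0 <= x -> 1 + x ^+ 2 <= 2 * (1 + x `^ (3 / 4)) ^+ 4.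
Proof.
move=> x0; set y := x `^ (3 / 4); have y0 : 0 <= y := powR_ge0 _ _.
have y4 : y ^+ 4 = x ^+ 3.
  rewrite /y -powR_mulrn ?powR_ge0// -powRrM (_ : 3 / 4 * 4 = 3); last by field.
  by rewrite -powR_mulrn.
have y14 : 1 + y ^+ 4 <= (1 + y) ^+ 4.
  rewrite -subr_ge0 (_ : _ - _ = y * (4 + 6 * y + 4 * y ^+ 2)); last by ring.
  by rewrite mulr_ge0// !addr_ge0// mulr_ge0// exprn_ge0.
have [x1|x1] := leP x 1.
  have : x ^+ 2 <= 1 by rewrite exprn_ile1.
  have : 0 <= y ^+ 4 by rewrite exprn_ge0.
  lra.
have : x ^+ 2 <= x ^+ 3 by rewrite [leRHS]exprS ler_peMl ?exprn_ge0// ltW.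
rewrite -y4; have : 0 <= y ^+ 4 by rewrite exprn_ge0.
lra.
Qed.

(** With $y=x^{3/4}$, the fourth power of $e^{cy/2}\ge1+cy/2\ge m(1+y)$ dominates $m^4(1+x^2)/2$,
    because $y^4=x^3$. *)
Lemma expRN_pow_le (c : R) : 0 < c -> exists2 M, 0 <= M &
  forall x, 0 <= x -> expR (- (c * x `^ (3 / 4))) ^+ 2 <= M / (1 + x ^+ 2).
Proof.
move=> c0; pose m := Num.min 1 (c / 2); have m0 : 0 < m by rewrite lt_min ltr01 divr_gt0.
exists (2 / m ^+ 4) => [|x x0]; first by rewrite divr_ge0// exprn_ge0// ltW.
have := oneDsqr_le_pow x0; set y := x `^ (3 / 4) => h.
have y0 : 0 <= y := powR_ge0 _ _.
have x2 : 0 < 1 + x ^+ 2 by rewrite ltr_wpDr// sqr_ge0.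
have e1 : m * (1 + y) <= expR (c * y / 2).
  apply: (le_trans _ (expR_ge1Dx _)); rewrite mulrDr mulr1 lerD//.
    by rewrite /m ge_min lexx.
  by rewrite [leRHS]mulrAC ler_wpM2r// /m ge_min lexx orbT.
have e4 : (m * (1 + y)) ^+ 4 <= expR (c * y) ^+ 2.
  rewrite (_ : expR (c * y) = expR (c * y / 2) ^+ 2); last first.
    by rewrite -expRM_natl; congr expR; rewrite -mulr_natl; field.
  rewrite -exprM; apply: lerXn2r; rewrite ?nnegrE ?expR_ge0// mulr_ge0 ?addr_ge0// ltW//.
rewrite expRN exprVn ler_pdivlMr// ler_pdivrMl ?exprn_gt0 ?expR_gt0//.
apply: (le_trans h).
rewrite [leRHS]mulrCA; apply: ler_wpM2l => //.
by rewrite ler_pdivlMr ?exprn_gt0// mulrC -exprMn.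
Qed.

Lemma gevrey_class_C T C A v : 0 <= T -> 1 <= A -> gevrey T C A v -> class_C R v.
Proof.
move=> T0 A1 g; have cv := gevrey_continuous g; have A0 : 0 < A by lra.
have C0 := gevrey_C_ge0 g.
have mv : measurable_fun setT v by apply: continuous_measurable_fun.
split.
  have -> : L2plus v = (v \_ Rplus \in Lfun mu 2%:E) by [].
  have -> : v \_ Rplus = v.
    apply/funext => t; rewrite patchE; case: ifPn => // tR; rewrite g.1//.
    by apply: contra tR => /andP[t0 _]; rewrite inE /Rplus /= in_itv /= t0.
  rewrite inE; apply/andP; split; first by rewrite inE.
  rewrite inE /= /finite_norm; apply: (@le_lt_trans _ _ (Num.sqrt (C ^+ 2 * T))%:E); last by rewrite ltry.
  apply: Lnorm2_le; first exact: sqrtr_ge0.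
  rewrite sqr_sqrtr ?mulr_ge0 ?sqr_ge0//.
  have m2 : measurable_fun setT (fun t => v t ^+ 2) by exact: measurable_funX.
  have b2 t : `|v t ^+ 2| <= C ^+ 2.
    rewrite normrX lerXn2r ?nnegrE//; exact: gevrey_bounded g.
  have s2 : supp T (fun t => v t ^+ 2) by move=> t tT; rewrite g.1// expr0n.
  have := Rintegral_Rplus_le T0 m2 b2 s2.
  rewrite (Rintegral_supp measurable_Rplus (@sub_itv_Rplus _ T) s2).
  move=> /(le_trans (ler_norm _)); rewrite -lee_fin /Rintegral fineK//.
  exact: integrable_fin_num (integrable_supp m2 b2 s2).
pose c := rate A; have c_gt0 : 0 < c := rate_gt0 A0.
(* With $\alpha=c/4$, $|K(p)|^{-1}\le e^{(c/4)(2|p|^{3/4}+2)}$ consumes half of the decay rate $c$.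
   The factor $e^{-(c/2)|p|^{3/4}}$ is left for square integrability. *)
exists (c / 4), 1, (3 / 4)%Q; split => //.
- by rewrite divr_gt0.
have -> : ratr (3 / 4 : rat) = 3 / 4 :> R by rewrite fmorph_div /= !ratr_nat.
pose D := 2 * C * (T + 1) * expR 2.
have D0 : 0 <= D by rewrite !mulr_ge0 ?addr_ge0 ?expR_ge0.
have KE p : (kernel_K (c / 4) 1 (3 / 4) p)^-1 = cexp ((c / 4)%:C * cpow (p + 1%:C) (3 / 4)).
  by rewrite /kernel_K cexpV opprK.
have [M M0 HM] := @expRN_pow_le (c / 2) (divr_gt0 c_gt0 (ltr0Sn R 1)).
apply: (@Hardy2_of_bound _ ((D * expR (c / 2)) ^+ 2 * M)).
- by rewrite mulr_ge0// sqr_ge0.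
- move=> p p0.
  have -> : (fun p => (kernel_K (c / 4) 1 (3 / 4) p)^-1 * Laplace v p) =
    ((cexp \o (fun z => (c / 4)%:C * cpow (z + 1%:C) (3 / 4)) : R[i]^o -> R[i]^o) * (Laplace v : R[i]^o -> R[i]^o)).
    by apply/funext => z; rewrite KE.
  apply: (@derivableM (R[i]) (R[i]^o)); last exact: holomorphic_Laplace T0 g p p0.
  apply: derivable_ccomp; last exact: derivable_cexp.
  apply: (@derivableM (R[i]) (R[i]^o) (cst (c / 4)%:C) (fun z => cpow (z + 1%:C) (3 / 4))).
    exact: derivable_cst.
  apply: (@derivable_ccomp R (fun z => z + 1%:C) (fun z => cpow z (3 / 4))).
    by apply: (@derivableD (R[i]) (R[i]^o) (R[i]^o) id (cst 1%:C)); [exact: derivable_id|exact: derivable_cst].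
  by apply: derivable_cpow; rewrite raddfD /= addr_gt0.
- move=> p p0; rewrite cmodM KE cmod_cexp.
  have L := Laplace_decay T0 A1 g (ltW p0).
  set r := cmod p `^ (3 / 4) in L.
  have K1 : expR (Re ((c / 4)%:C * cpow (p + 1%:C) (3 / 4))) <= expR (c / 2) * expR (c / 2 * r).
    rewrite -expRD ler_expR cReM /= mul0r subr0.
    apply: (@le_trans _ _ (c / 4 * (2 * r + 2))); last first.
      by rewrite le_eqVlt; apply/orP; left; apply/eqP; field.
    apply: ler_wpM2l; first by apply: divr_ge0 => //; exact: ltW.
    apply: (le_trans (ler_norm _)); apply: (le_trans (ler_Re_cmod (cpow _ _))).
    rewrite cmod_cpow; apply: (le_trans _ (powRD1_le (cmod_ge0 p))).
    rewrite ge0_ler_powR ?nnegrE ?cmod_ge0// ?addr_ge0 ?cmod_ge0//.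
    by rewrite (le_trans (ler_cmodD _ _))// cmod_real normr1.
  have H1 : expR (Re ((c / 4)%:C * cpow (p + 1%:C) (3 / 4))) * cmod (Laplace v p) <=
     D * expR (c / 2) * expR (- (c / 2 * r)).
    apply: (le_trans (ler_pM (expR_ge0 _) (cmod_ge0 _) K1 L)).
    rewrite -/D -/c le_eqVlt; apply/orP; left; apply/eqP.
    rewrite (_ : - (c * r) = - (c / 2 * r) - (c / 2 * r)); last by field.
    rewrite expRD [expR (- (c / 2 * r))]expRN; field.
    by rewrite gt_eqF// expR_gt0.
  have e0 : 0 <= expR (- (c / 2 * r)) by exact: expR_ge0.
  have H2 := HM _ (cmod_ge0 p).
  apply: (@le_trans _ _ ((D * expR (c / 2) * expR (- (c / 2 * r))) ^+ 2)).
    apply: lerXn2r => //; rewrite nnegrE; apply: mulr_ge0 => //.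
      exact: cmod_ge0.
    by apply: mulr_ge0 => //; exact: expR_ge0.
  rewrite [leLHS]exprMn -[leRHS]mulrA; apply: ler_wpM2l; first exact: sqr_ge0.
  apply: (le_trans H2); rewrite ler_wpM2l// lef_pV2 ?posrE ?ltr_wpDr ?sqr_ge0//.
  by rewrite lerD2l sqr_cmod lerDr sqr_ge0.
Qed.

End class_C_gevrey.

(** * Density *)

Section gevrey_approximation.
Context {R : realType}.
Implicit Types (f g u v : R -> R) (T M A B C h t x : R).

Lemma iter_bdiff_shift f h x k :
  iter k (bdiff h) (fun t => f (t - x)) = (fun t => iter k (bdiff h) f (t - x)).
Proof.
by elim: k => //= k ->; apply/funext => t; rewrite /bdiff addrAC.
Qed.

Lemma iter_bdiffB f g h k :
  iter k (bdiff h) (fun t => f t - g t) = (fun t => iter k (bdiff h) f t - iter k (bdiff h) g t).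
Proof.
elim: k => //= k ->; apply/funext => t; rewrite /bdiff; ring.
Qed.

Lemma iter_bdiffD f g h k :
  iter k (bdiff h) (fun t => f t + g t) = (fun t => iter k (bdiff h) f t + iter k (bdiff h) g t).
Proof.
elim: k => //= k ->; apply/funext => t; rewrite /bdiff; ring.
Qed.

Lemma iter_bdiffZ f (c : R) h k :
  iter k (bdiff h) (fun t => c * f t) = (fun t => c * iter k (bdiff h) f t).
Proof.
elim: k => //= k ->; apply/funext => t; rewrite /bdiff; ring.
Qed.

Lemma diff_bound_shift C A v x : diff_bound C A v -> diff_bound C A (fun t => v (t - x)).
Proof. by move=> b k h t h0; rewrite iter_bdiff_shift; exact: b. Qed.

Lemma diff_boundB C C' A f g : diff_bound C A f -> diff_bound C' A g ->
  diff_bound (C + C') A (fun t => f t - g t).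
Proof.
move=> bf bg k h t h0; rewrite iter_bdiffB mulrDl (le_trans (ler_normB _ _))//.
by rewrite lerD ?bf ?bg.
Qed.

Lemma diff_boundD C C' A f g : diff_bound C A f -> diff_bound C' A g ->
  diff_bound (C + C') A (fun t => f t + g t).
Proof.
move=> bf bg k h t h0; rewrite iter_bdiffD mulrDl (le_trans (ler_normD _ _))//.
by rewrite lerD ?bf ?bg.
Qed.

Lemma diff_boundZ C A f (c : R) : diff_bound C A f -> diff_bound (`|c| * C) A (fun t => c * f t).
Proof.
by move=> bf k h t h0; rewrite iter_bdiffZ normrM -[leRHS]mulrA ler_wpM2l// bf.
Qed.

Lemma diff_bound0 A : diff_bound 0 A (fun _ => 0).
Proof.
move=> k h t h0; rewrite mul0r (_ : iter _ _ _ = fun _ => 0) ?normr0//.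
by elim: k => //= k ->; apply/funext => s; rewrite /bdiff subrr.
Qed.

Lemma diff_bound_sum A n (C_ : nat -> R) (u_ : nat -> R -> R) :
  (forall i, diff_bound (C_ i) A (u_ i)) ->
  diff_bound (\sum_(i < n) C_ i) A (fun t => \sum_(i < n) u_ i t).
Proof.
move=> b; elim: n => [|n IH].
  rewrite big_ord0 (_ : (fun t => _) = fun _ => 0); first exact: diff_bound0.
  by apply/funext => t; rewrite big_ord0.
have -> : (fun t => \sum_(i < n.+1) u_ i t) = (fun t => \sum_(i < n) u_ i t + u_ n t).
  by apply/funext => t; rewrite big_ord_recr.
by rewrite big_ord_recr; exact: diff_boundD.
Qed.

Lemma diff_bound_le C A B v : 0 <= C -> 0 <= A -> A <= B -> diff_bound C A v -> diff_bound C B v.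
Proof.
move=> C0 A0 AB b k h t h0; apply: (le_trans (b k h t h0)); apply: ler_wpM2l => //.
have K0 := powR_ge0 (k.+1%:R : R) (4 / 3); have B0 := le_trans A0 AB.
apply: lerXn2r; rewrite ?nnegrE.
- by apply: mulr_ge0; [apply: mulr_ge0|exact: ltW].
- by apply: mulr_ge0; [apply: mulr_ge0|exact: ltW].
- by rewrite ler_pM2r// ler_wpM2r.
Qed.

Variables (g : R -> R) (M X : R).
Hypotheses (gM : forall t, `|g t| <= M) (X0 : 0 < X).

Let mesh (n : nat) : R := X / n.+1%:R.

Let mesh_gt0 n : 0 < mesh n. Proof. by rewrite divr_gt0. Qed.

(** The approximant is $\sum_i g(im)\,w_i$ with $w_i(t)=\Phi(t-im)-\Phi(t-(i+1)m)$. The weights are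
    nonnegative, $w_i$ lives on $[im,(i+2)m]$, and they telescope to $\Phi(t)-\Phi(t-X)$, which is 1
    on $[m,X]$. There $v(t)$ is a mean of values of $g$ within distance $2m$ of $t$; on $[0,m]$ it
    climbs from 0. *)
Lemma gevrey_approx (n : nat) : exists v : R -> R,
  [/\ exists C A, 1 <= A /\ gevrey (2 * X) C A v, forall t, `|v t| <= M,
     forall t, X + mesh n <= t -> v t = 0 &
     forall t B (d : R), mesh n <= t <= X -> 2 * mesh n <= d ->
       (forall s, `|t - s| <= d -> `|g t - g s| <= B) -> `|g t - v t| <= B].
Proof.
set m := mesh n; have m0 : 0 < m by exact: mesh_gt0.
have mn : n.+1%:R * m = X by rewrite /m /mesh mulrC divfK.
have mX : m <= X by rewrite -mn ler_peMl ?ler1n// ltW.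
(* The parameter $m/2$ makes the climb fit into one mesh. *)
have [Phi [A [A0 P0 P1 Pm Pd]]] := gevrey_step (divr_gt0 m0 (ltr0Sn R 1)).
have {}P1 t : m <= t -> Phi t = 1.
  by move=> tm; apply: P1; rewrite mulrC divfK.
pose w (i : nat) t := Phi (t - i%:R * m) - Phi (t - i.+1%:R * m).
have w0 i t : 0 <= w i t.
  by rewrite subr_ge0; apply: Pm; rewrite lerD2l lerN2 ler_pM2r// ler_nat.
have wsum k t : \sum_(i < k) w i t = Phi t - Phi (t - k%:R * m).
  elim: k => [|k IH]; first by rewrite big_ord0 mul0r subr0 subrr.
  by rewrite big_ord_recr /= IH /w addrA subrK.
have Phi01 t : 0 <= Phi t <= 1.
  apply/andP; split.
    have [/P0 ->//|/ltW t0] := leP t 0; rewrite -(P0 0 (lexx _)); exact: Pm.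
  have [/P1 ->//|/ltW t0] := leP m t; rewrite -(P1 m (lexx _)); exact: Pm.
have wsum1 k t : \sum_(i < k) w i t <= 1.
  rewrite wsum; have /andP[_ h1] := Phi01 t; have /andP[h2 _] := Phi01 (t - k%:R * m).
  lra.
have w_le0 i t : t <= 0 -> w i t = 0.
  move=> t0; have i1 : 0 <= i%:R * m by rewrite mulr_ge0// ltW.
  have i2 : 0 <= i.+1%:R * m by rewrite mulr_ge0// ltW.
  by rewrite /w !P0 ?subrr//; lra.
have w_ge i t : i.+1%:R * m + m <= t -> w i t = 0.
  rewrite -natr1 mulrDl mul1r => ti.
  by rewrite /w -natr1 mulrDl mul1r !P1 ?subrr//; lra.
have w_ltl i t : t <= i%:R * m -> w i t = 0.
  by move=> ti; rewrite /w -natr1 mulrDl mul1r !P0 ?subrr//; lra.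
pose v t := \sum_(i < n.+1) g (i%:R * m) * w i t.
have iX (i : 'I_n.+1) : i.+1%:R * m <= X by rewrite -mn ler_pM2r// ler_nat ltn_ord.
have v_ge t : X + m <= t -> v t = 0.
  move=> tX; rewrite /v big1// => i _; rewrite w_ge ?mulr0//.
  by have := iX i; lra.
exists v; split.
(* The decay estimate asks for a constant at least 1. Both constants may depend on the mesh, since
   each approximant only has to lie in the class. *)
- exists (\sum_(i < n.+1) `|g (i%:R * m)| * (1 + 1)), (Num.max 1 A); split.
    by rewrite le_max lexx.
  split.
    move=> t; rewrite negb_and -!ltNge => /orP[t0|tX].
      by rewrite /v big1// => i _; rewrite w_le0 ?mulr0// ltW.
    by apply: v_ge; lra.
  have dP : diff_bound 1 (Num.max 1 A) Phi.
    apply: (@diff_bound_le 1 A) => //; [exact: ltW|by rewrite le_max lexx orbT|].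
    by move=> k h t h0; rewrite mul1r; exact: Pd.
  apply: (@diff_bound_sum _ n.+1 (fun i => `|g (i%:R * m)| * (1 + 1)) (fun i t => g (i%:R * m) * w i t)) => i.
  by apply: diff_boundZ; apply: diff_boundB; exact: diff_bound_shift.
- move=> t; apply: (le_trans (ler_norm_sum _ _ _)).
  apply: (@le_trans _ _ (\sum_(i < n.+1) M * w i t)).
    by apply: ler_sum => i _; rewrite normrM (ger0_norm (w0 _ _)) ler_wpM2r.
  rewrite -mulr_sumr ler_piMr//; exact: le_trans (gM 0).
- exact: v_ge.
- move=> t B d /andP[mt tX] md gd.
  have s1 : \sum_(i < n.+1) w i t = 1 by rewrite wsum mn P1// P0 ?subr0//; lra.
  have -> : g t - v t = \sum_(i < n.+1) (g t - g (i%:R * m)) * w i t.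
    rewrite /v -[X in X - _]mulr1 -s1 mulr_sumr -sumrB.
    by apply: eq_bigr => i _; rewrite mulrBl.
  apply: (le_trans (ler_norm_sum _ _ _)).
  apply: (@le_trans _ _ (\sum_(i < n.+1) B * w i t)); last by rewrite -mulr_sumr s1 mulr1.
  apply: ler_sum => i _; rewrite normrM (ger0_norm (w0 _ _)).
  have [ti|ti] := leP t (i%:R * m); first by rewrite w_ltl// !mulr0.
  have [ti2|ti2] := leP (i.+1%:R * m + m) t; first by rewrite w_ge// !mulr0.
  rewrite ler_wpM2r// gd// ger0_norm ?subr_ge0 1?ltW//.
  by move: ti2; rewrite -natr1 mulrDl mul1r; lra.
Qed.

End gevrey_approximation.

(** * Approximation in the space of square integrable functions *)

Section density.
Context {R : realType}.
Implicit Types (f g u v : R -> R) (T M C t x e : R).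

Lemma near_lt_of_cvg0 (u_ : nat -> \bar R) e : 0 < e -> u_ n @[n --> \oo] --> 0%E ->
  exists n, (u_ n < e%:E)%E.
Proof.
move=> e0 uc.
have : nbhs (0 : \bar R)%E [set x | (x < e%:E)%E].
  by apply: open_nbhs_nbhs; split; [exact: open_ereal_lt_ereal|rewrite /= lte_fin].
by move=> /uc [n _ /(_ n (leqnn n))] h; exists n.
Qed.

(** Convergence is asked off $t=0$ only, because Gevrey approximants vanish at 0 whatever the value
    of the target there. *)
Lemma dominated_sqr (u_ : nat -> R -> R) (d : R -> R) :
  (forall n, measurable_fun setT (u_ n)) ->
  (forall t, t != 0 -> u_ n t @[n --> \oo] --> (0 : R)) ->
  mu.-integrable setT (EFin \o d) -> (forall n t, (u_ n t) ^+ 2 <= d t) ->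
  forall e, 0 < e -> exists n, (\int[mu]_t ((u_ n t) ^+ 2)%:E <= e%:E)%E.
Proof.
move=> mu_ u0 di ud e e0.
have [] := @dominated_convergence _ _ R mu setT measurableT
  (fun n t => ((u_ n t) ^+ 2)%:E) (cst 0%E) (EFin \o d).
- by move=> n; apply/measurable_EFinP; apply: measurable_funX; exact: mu_.
- exact: measurable_cst.
- exists [set 0]; split; [exact: measurable_set1|exact: lebesgue_measure_set1|].
  move=> t; apply: contra_notP => /eqP t0 _ /=.
  apply: cvg_EFin; first by apply: nearW.
  have h := u0 t t0.
  have h2 := cvgM h h; rewrite mulr0 in h2.
  have E : (fun n => u_ n t ^+ 2) = (fun n => u_ n t * u_ n t).
    by apply/funext => n; rewrite expr2.
  have h3 : (fun n => u_ n t ^+ 2) n @[n --> \oo] --> (0 : R) by rewrite E; exact: h2.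
  exact: h3.
- exact: di.
- by apply: aeW => t n _; rewrite /= lee_fin ger0_norm ?sqr_ge0.
move=> _ _; rewrite integral0 => /(near_lt_of_cvg0 e0)[n nE].
by exists n; exact: ltW.
Qed.

Definition clamp M x : R := Num.max (- M) (Num.min M x).

Lemma clamp_bound M x : 0 <= M -> `|clamp M x| <= M.
Proof.
move=> M0; rewrite /clamp ler_norml; apply/andP; split; first by rewrite le_max lexx.
by rewrite ge_max ge_min lexx; lra.
Qed.

Lemma clamp_id M x : `|x| <= M -> clamp M x = x.
Proof.
rewrite ler_norml => /andP[x1 x2]; rewrite /clamp.
by rewrite min_r// max_r.
Qed.

Lemma clamp_lip M x y : `|clamp M x - clamp M y| <= `|x - y|.
Proof.
wlog yx : x y / y <= x => [H|].
  by have [/H//|/ltW/H] := leP y x; rewrite distrC [leRHS]distrC.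
have : 0 <= clamp M x - clamp M y <= x - y.
  rewrite /clamp; have [?|?] := leP M x; have [?|?] := leP M y;
  have [?|?] := leP (- M) M; have [?|?] := leP (- M) x; have [?|?] := leP (- M) y;
  by apply/andP; split; lra.
by move=> /andP[c0 cxy]; rewrite !ger0_norm// subr_ge0.
Qed.

Lemma clamp_le M x : 0 <= M -> `|clamp M x| <= `|x|.
Proof.
move=> M0; have := clamp_lip M x 0; rewrite (clamp_id (x := 0)) ?normr0//.
by rewrite !subr0.
Qed.

Lemma continuous_clamp M : continuous (clamp M).
Proof.
apply: (@continuous_of_lipschitz _ 1) => s t st.
by rewrite mul1r -(ger0_norm (x := t - s)) ?subr_ge0// clamp_lip.
Qed.

Lemma measurable_clamp M f : measurable_fun setT f -> measurable_fun setT (fun t => clamp M (f t)).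
Proof.
move=> mf; apply: (measurableT_comp (f := clamp M)) => //.
by apply: continuous_measurable_fun; exact: continuous_clamp.
Qed.

(** For $0<t\le X$ continuity of $g$ at $t$ controls the error once the mesh is small; for $t>X$ the
    approximant is eventually 0. All errors are at most $2M$ and supported in $[0,2X]$. *)
Lemma gevrey_L2_approx g M X e : continuous g -> (forall t, `|g t| <= M) -> 0 < X -> 0 < e ->
  exists v, [/\ exists T C A, [/\ 0 <= T, 1 <= A & gevrey T C A v] &
    (\int[mu]_t ((\1_(`[0, X]%classic : set R) t * g t - v t) ^+ 2)%:E <= e%:E)%E].
Proof.
move=> cg gM X0 e0.
pose mesh (n : nat) : R := X / n.+1%:R.
pose v_ n := projT1 (cid (gevrey_approx gM X0 n)).
have vP n := projT2 (cid (gevrey_approx gM X0 n)).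
pose G t := \1_(`[0, X]%classic : set R) t * g t.
have M0 : 0 <= M := le_trans (normr_ge0 _) (gM 0).
have mv n : measurable_fun setT (v_ n).
  have [[C [A [A1 gv]]] _ _ _] := vP n.
  by apply: continuous_measurable_fun; exact: gevrey_continuous gv.
have mG : measurable_fun setT G.
  by apply: measurable_funM; [exact: measurable_indic|exact: continuous_measurable_fun].
have GM t : `|G t| <= M.
  rewrite /G indicE; case: (_ \in _); first by rewrite mul1r.
  by rewrite mul0r normr0.
have sG : supp (2 * X) G.
  move=> t tX; rewrite /G indicE memNset ?mul0r//= in_itv/=.
  by move=> /andP[t0 tX']; move: tX; rewrite t0 /=; apply/negP; rewrite negbK; lra.
pose d t := (2 * M) ^+ 2 * \1_(`[0, (2 * X)]%classic : set R) t.
have vM n t : `|v_ n t| <= M by have [_ + _ _] := vP n; exact.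
have sv n : supp (2 * X) (v_ n) by have [[C [A [_ [+ _]]]] _ _ _] := vP n.
have vz n s : X + mesh n <= s -> v_ n s = 0 by have [_ _ + _] := vP n; exact.
have [] := @dominated_sqr (fun n t => G t - v_ n t) d _ _ _ _ e e0.
- by move=> n; exact: measurable_funB.
- move=> t t0; apply/cvgrPdist_lt => eta eta0.
  have mesh_small (y : R) : 0 < y -> \forall n \near \oo, mesh n <= y.
    move=> y0; near=> n; rewrite /mesh ler_pdivrMr// mulrC -ler_pdivrMr//.
    apply: le_trans (_ : n%:R <= _); last by rewrite ler_nat.
    near: n; exact: nbhs_infty_ger.
  have [tX|tX] := boolP (0 <= t <= X); last first.
    have G0 : G t = 0 by rewrite /G indicE memNset ?mul0r//= in_itv/=; apply/negP.
    move: tX; rewrite negb_and -!ltNge => /orP[tneg|tX].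
      apply: nearW => n; rewrite G0 sv ?subrr ?normr0//.
      by rewrite negb_and -ltNge tneg.
    near=> n; rewrite G0 vz; first by rewrite !subr0 normr0.
    rewrite addrC -lerBrDr; near: n; apply: mesh_small; lra.
  have [t0' tX'] := andP tX.
  have tp : 0 < t by rewrite lt_def t0.
  have Gt : G t = g t by rewrite /G indicE mem_set ?mul1r//= in_itv.
  have /cvgrPdist_le /(_ (eta / 2)) := cg t.
  rewrite divr_gt0// => /(_ isT) /nbhs_ballP[r /= r0 rg].
  near=> n; rewrite sub0r normrN Gt.
  apply: (@le_lt_trans _ _ (eta / 2)); last by lra.
  have [_ _ _ H] := vP n; apply: (H t (eta / 2) (r / 2)).
  - rewrite tX' andbT; near: n; exact: mesh_small.
  - rewrite mulrC -ler_pdivlMr//; near: n; apply: mesh_small; rewrite !divr_gt0//.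
  - move=> s ts; apply: rg; rewrite /ball /=; lra.
- have di : mu.-integrable setT (EFin \o (\1_(`[0, (2 * X)]%classic : set R) : R -> R)).
    exact: integrable_indic_itv.
  by apply: eq_integrable (integrableZl _ ((2 * M) ^+ 2) di).
- move=> n t; rewrite /d indicE.
  have [tX|tX] := boolP (t \in _); last first.
    have tX' : ~~ (0 <= t <= 2 * X) by apply: contra tX => tX; apply/mem_set; rewrite /= in_itv.
    by rewrite sG// sv// subrr expr0n/= mulr0.
  rewrite mulr1 -(@real_normK _ (G t - v_ n t)) ?num_real//.
  apply: lerXn2r; rewrite ?nnegrE ?mulr_ge0//.
  by rewrite (le_trans (ler_normB _ _))//; have := GM t; have := vM n t; lra.
move=> n nE; exists (v_ n); split => //.
have [[C [A [A1 gv]]] _ _ _] := vP n.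
by exists (2 * X), C, A; split => //; rewrite mulr_ge0// ltW.
Unshelve. all: by end_near.
Qed.

(** Density of continuous functions in $L_1$ is enough: between functions bounded by $N$ the squared
    distance is at most $2N$ times the distance. Clamping supplies that bound and, being 1-Lipschitz
    and fixing the values of $f$, does not increase the error. *)
Lemma continuous_L2_approx f N e : measurable_fun setT f -> (forall t, `|f t| <= N) ->
  0 < N -> 0 < e -> exists g, [/\ continuous g, forall t, `|g t| <= N &
    (\int[mu]_t ((\1_(`[0, N]%classic : set R) t * (f t - g t)) ^+ 2)%:E <= e%:E)%E].
Proof.
move=> mf fN N0 e0; pose E := `[0, N]%classic : set R.
have mE : measurable E by exact: measurable_itv.
have muE : (mu E < +oo)%E by rewrite /= lebesgue_measure_itv/=; case: ifP => // _; rewrite -EFinD ltry.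
have fi : mu.-integrable E (EFin \o f).
  apply: measurable_bounded_integrable => //; first exact: measurable_funS mf.
  by exists N; split; rewrite ?num_real // => x Nx t _; exact: le_trans (ltW Nx).
have [g_ [cg gi gc]] := approximation_continuous_integrable mE muE fi.
have [n nE] := near_lt_of_cvg0 (divr_gt0 e0 (mulr_gt0 (ltr0Sn R 1) N0)) gc.
exists (fun t => clamp N (g_ n t)); split.
- by move=> t; apply: (@continuous_comp _ _ _ (g_ n) (clamp N)); [exact: cg|exact: continuous_clamp].
- by move=> t; apply: clamp_bound; exact: ltW.
have mg : measurable_fun setT (g_ n) by apply: continuous_measurable_fun; exact: cg.
apply: (@le_trans _ _ (\int[mu]_(t in E) ((2 * N)%:E * `|(f t - g_ n t)%:E|))%E).
  rewrite [leRHS]integral_mkcond; apply: ge0_le_integral => //.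
  - by move=> t _; rewrite lee_fin sqr_ge0.
  - apply/measurable_EFinP; apply: measurable_funX; apply: measurable_funM; first exact: measurable_indic.
    by apply: measurable_funB => //; exact: measurable_clamp.
  - apply/(measurable_restrictT _ mE); apply: measurable_funTS.
    apply: measurable_funeM; apply: measurableT_comp => //.
    by apply/measurable_EFinP; exact: measurable_funB.
  - move=> t _; rewrite patchE indicE; case: ifPn => tE; last by rewrite mul0r expr0n.
    rewrite mul1r -EFinM lee_fin -(@real_normK _ (f t - _)) ?num_real// expr2.
    have h1 := clamp_lip N (f t) (g_ n t).
    rewrite (clamp_id (fN t)) in h1.
    apply: ler_pM => //.
    have := clamp_bound (g_ n t) (ltW N0); have := fN t.
    by move=> h2 h3; rewrite (le_trans (ler_normB _ _))//; lra.
rewrite ge0_integralZl//.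
- apply: (@le_trans _ _ ((2 * N)%:E * (e / (2 * N))%:E)%E).
    by apply: lee_wpmul2l; [rewrite lee_fin mulr_ge0// ltW|exact: ltW].
  by rewrite -EFinM lee_fin mulrC divfK// mulf_neq0// gt_eqF.
- apply: measurable_funTS; apply: measurableT_comp => //.
  by apply/measurable_EFinP; exact: measurable_funB.
- by rewrite lee_fin mulr_ge0// ltW.
Qed.

(** Domain and values are cut at the same $N$. At each $t$ the error is 0 as soon as
    $N\ge\max(t,|f(t)|)$, and its square is dominated by $4f^2$. *)
Lemma truncation_L2_approx f e : measurable_fun setT f ->
  (\int[mu]_t ((f t) ^+ 2)%:E < +oo)%E -> (forall t, t < 0 -> f t = 0) -> 0 < e ->
  exists2 N, 0 < N &
    (\int[mu]_t ((f t - \1_(`[0, N]%classic : set R) t * clamp N (f t)) ^+ 2)%:E <= e%:E)%E.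
Proof.
move=> mf fi f0 e0.
have [] := @dominated_sqr
  (fun n t => f t - \1_(`[0, n.+1%:R]%classic : set R) t * clamp n.+1%:R (f t))
  (fun t => f t ^+ 2 *+ 4) _ _ _ _ e e0.
- move=> n; apply: measurable_funB => //; apply: measurable_funM; first exact: measurable_indic.
  exact: measurable_clamp.
- move=> t _; apply/cvgrPdist_lt => eta eta0; near=> n.
  have tn : t <= n.+1%:R.
    apply: le_trans (_ : n%:R <= _); last by rewrite ler_nat.
    near: n; exact: nbhs_infty_ger.
  have ft : `|f t| <= n.+1%:R.
    apply: le_trans (_ : n%:R <= _); last by rewrite ler_nat.
    near: n; exact: nbhs_infty_ger.
  rewrite clamp_id// indicE; have [t0|t0] := ltP t 0.
    by rewrite f0// mulr0 subrr subrr normr0.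
  by rewrite mem_set ?mul1r ?subrr ?subr0 ?normr0//= in_itv/= t0.
- apply/integrableP; split; first by apply/measurable_EFinP; under eq_fun do rewrite -mulr_natl; apply: measurable_funM => //; exact: measurable_funX.
  under eq_integral => t _ do rewrite /= -[`|_ *+ _|]/(`|_|) -mulr_natl normrM (ger0_norm (sqr_ge0 (f t))) EFinM.
  rewrite ge0_integralZl//.
  + by apply: lte_mul_pinfty => //; rewrite ger0_norm ?lee_fin.
  + by apply/measurable_EFinP; exact: measurable_funX.
  + by move=> t _; rewrite lee_fin sqr_ge0.
- move=> n t; rewrite -(@real_normK _ (f t - _)) ?num_real// -(@real_normK _ (f t)) ?num_real//.
  have -> : `|f t| ^+ 2 *+ 4 = (`|f t| + `|f t|) ^+ 2 by ring.
  apply: lerXn2r; rewrite ?nnegrE ?addr_ge0//.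
  rewrite (le_trans (ler_normB _ _))// lerD// normrM -[leRHS]mul1r.
  apply: ler_pM => //; last exact: clamp_le.
  by rewrite indicE; case: (_ \in _); rewrite ?normr1 ?normr0.
by move=> n nE; exists n.+1%:R.
Unshelve. all: by end_near.
Qed.

End density.

Theorem mainTheorem2 (R : realType) : dense_in_L2plus (class_C R).
Proof.
split; first by move=> v [].
move=> f0 f0L e e0; pose f := f0 \_ Rplus.
have fL : f \in Lfun mu 2%:E by exact: f0L.
have mf : measurable_fun setT f by move: fL; rewrite inE => /andP[/[!inE]].
have fi : (\int[mu]_t ((f t) ^+ 2)%:E < +oo)%E.
  move: fL; rewrite inE => /andP[_]; rewrite inE /= /finite_norm Lnorm2E.
  by apply: lty_poweRy; rewrite invr_neq0.
have fneg t : t < 0 -> f t = 0.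
  by move=> t0; rewrite /f patchE memNset// /Rplus /= in_itv/= andbT; apply/negP; rewrite -ltNge.
(* Each of the three approximations costs $e/4$ in norm; Minkowski's inequality then leaves
   $3e/4<e$. *)
pose e' := (e / 4) ^+ 2; have e'0 : 0 < e' by rewrite exprn_gt0// divr_gt0.
have [N N0 H1] := truncation_L2_approx mf fi fneg e'0.
have [g [cg gN H2]] := continuous_L2_approx (measurable_clamp N mf) (fun t => clamp_bound (f t) (ltW N0)) N0 e'0.
have [v [[T [C [A [T0 A1 gv]]]] H3]] := gevrey_L2_approx cg gN N0 e'0.
exists v; first exact: gevrey_class_C gv.
have cv := gevrey_continuous gv.
have mv : measurable_fun setT v by exact: continuous_measurable_fun.
pose I : R -> R := \1_(`[0, N]%classic : set R).
have mI : measurable_fun setT I by exact: measurable_indic.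
pose u1 t := f t - I t * clamp N (f t).
pose u2 t := I t * (clamp N (f t) - g t).
pose u3 t := I t * g t - v t.
have mc := measurable_clamp N mf.
have mg : measurable_fun setT g by exact: continuous_measurable_fun.
have m1 : measurable_fun setT u1 by apply: measurable_funB => //; exact: measurable_funM.
have m2 : measurable_fun setT u2 by apply: measurable_funM => //; exact: measurable_funB.
have m3 : measurable_fun setT u3 by apply: measurable_funB => //; exact: measurable_funM.
have e4 : 0 <= e / 4 by rewrite divr_ge0// ltW.
have n1 := Lnorm2_le e4 H1; have n2 := Lnorm2_le e4 H2; have n3 := Lnorm2_le e4 H3.
have E : (f0 \- v) \_ Rplus = (u1 \+ u2) \+ u3.
  apply/funext => t; rewrite patchE -[RHS]/(u1 t + u2 t + u3 t) /u1 /u2 /u3.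
  have [tR|tR] := boolP (t \in Rplus).
    have -> : f t = f0 t by rewrite /f patchE tR.
    by rewrite -[LHS]/(f0 t - v t); ring.
  have -> : f t = 0 by rewrite /f patchE (negbTE tR).
  have -> : v t = 0.
    by apply: gv.1; apply: contra tR => /andP[t0 _]; rewrite inE /Rplus /= in_itv/= t0.
  by rewrite -[LHS]/(0 : R); ring.
rewrite /L2plus_dist E.
apply: (@le_lt_trans _ _ ((e / 4)%:E + (e / 4)%:E + (e / 4)%:E)%E); last first.
  by rewrite -!EFinD lte_fin; lra.
have p1 : (1 <= 2 :> R) by rewrite ler1n.
have m12 : measurable_fun setT (u1 \+ u2) by exact: measurable_funD.
have k12 : ('N[mu]_2%:E[EFin \o (u1 \+ u2)%R] <= 'N[mu]_2%:E[EFin \o u1] + 'N[mu]_2%:E[EFin \o u2])%E.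
  exact: minkowski_EFin.
have k3 : ('N[mu]_2%:E[EFin \o ((u1 \+ u2) \+ u3)%R] <= 'N[mu]_2%:E[EFin \o (u1 \+ u2)%R] + 'N[mu]_2%:E[EFin \o u3])%E.
  exact: minkowski_EFin.
apply: (le_trans k3); apply: leeD; last exact: n3.
by apply: (le_trans k12); apply: leeD.
Qed.
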